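(* Let $\varepsilon\searrow0$ and let $(\mu_\varepsilon)_\varepsilon\subset\mathcal M(\Omega;E)$ be a sequence of asymptotically $\mathcal A$-free measures, i.e. such that $\mathcal A\mu_\varepsilon\to0$ strongly in $W^{-k,p}(\Omega)$, which two-scale converges to a limit $\lambda\otimes\theta_x$. Then, at $\lambda$-almost every $x_0\in\Omega$, $$\mathcal A_\xi\theta_{x_0}=0\quad\text{in the sense of distributions on }Z.$$
   Context: $\Omega\subset\mathbb R^d$ is open and bounded with $\mathscr L^d(\partial\Omega)=0$; $Z=\mathbb T^d=\mathbb R^d/\mathbb Z^d$; $E,F$ are finite-dimensional Euclidean spaces; $\mathcal M(\cdot;E)$ denotes bounded $E$-valued Radon measures. $\mathcal A=\sum_{|\alpha|=k}A_\alpha\partial^\alpha$, $A_\alpha\in\mathrm{Lin}(E;F)$, is a homogeneous constant-coefficient operator of order $k$ on $\mathbb R^d$; $\mathcal A_\xi$ denotes its action on $\mathcal D'(Z;E)$. The exponent satisfies $1<p<\frac d{d-1}$. Two-scale convergence: given $\lambda\in\mathcal M^+(\overline\Omega)$ and a weak-* $\lambda$-measurable map $\theta:\overline\Omega\to\mathcal M(Z;E)$ (i.e. $x\mapsto\theta_x(B)$ is $\lambda$-measurable for each Borel $B\subset Z$), $(\mu_\varepsilon)$ two-scale converges to $\lambda\otimes\theta_x$ if $$\int_\Omega\Psi\Big(x,\frac x\varepsilon\Big)\,d\mu_\varepsilon(x)\to\int_{\overline\Omega}\Big(\int_Z\Psi(x,\xi)\,d\theta_x(\xi)\Big)d\lambda(x)\qquad\text{for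 all }\Psi\in C(\overline\Omega\times Z),$$ where $x/\varepsilon$ is taken modulo $\mathbb Z^d$. *)

(* Defs.v *)
From HB Require Import structures.
From mathcomp Require Import all_boot all_order all_algebra.
From mathcomp Require Import all_classical all_reals all_analysis.
From mathcomp Require Import measurable_realfun.

Set Implicit Arguments.
Unset Strict Implicit.
Unset Printing Implicit Defensive.

Import Order.TTheory GRing.Theory Num.Theory.
Import numFieldNormedType.Exports.

Local Open Scope classical_set_scope.
Local Open Scope ring_scope.
Local Open Scope quotient_scope.

Notation borel T := (g_sigma_algebraType (@open T)).
Notation borelRd R d := (borel 'rV[R]_d).

Section lebesgue.
Variable R : realType.

Lemma borelRd_open d (U : set 'rV[R]_d) :
  open U -> measurable (U : set (borelRd R d)).
Proof. exact: sub_sigma_algebra. Qed.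

Lemma continuous_borelRd d d' (f : 'rV[R]_d -> 'rV[R]_d') :
  continuous f -> measurable_fun setT (f : borelRd R d -> borelRd R d').
Proof.
move=> cf.
apply: (@measurability _ _ (borelRd R d) (borelRd R d') setT f (@open 'rV[R]_d')) => //.
move=> _ [U oU <-]; rewrite setTI; apply: borelRd_open.
by move/continuousP : cf; apply.
Qed.

Definition ratball d (c : 'rV[rat]_d * rat) : set 'rV[R]_d :=
  ball (map_mx (@ratr R) c.1) (ratr c.2).

Lemma open_ratball d (U : set 'rV[R]_d) : open U ->
  U = \bigcup_(c in [set c | ratball c `<=` U]) ratball c.
Proof.
move=> oU; apply/seteqP; split; last by move=> x [c /= cU]; exact: cU.
move=> x Ux; have /nbhs_ballP[e /= e0 xeU] := open_nbhs_nbhs (conj oU Ux).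
have e20 : 0 < e / 2 by rewrite divr_gt0.
have [r] := rat_in_itvoo e20.
rewrite in_itv /= => /andP[r0 re].
have /choice[q qx] : forall i, exists q : rat, `|x 0 i - ratr q| < ratr r.
  move=> i; have xr : x 0 i - ratr r < x 0 i + ratr r.
    by rewrite ltrBlDr -addrA ltrDl addr_gt0.
  have [q] := rat_in_itvoo xr.
  rewrite in_itv /= => /andP[h1 h2]; exists q.
  by rewrite distrC ltr_distl h1 h2.
have xq : ball (map_mx (@ratr R) (\row_i q i)) (ratr r) x.
  split=> // i j; rewrite (ord1 i) !mxE /ball /= distrC; exact: qx.
exists (\row_i q i, r) => // y; rewrite /ratball /= => qy.
apply: xeU; apply: (@le_ball _ _ _ (ratr r + ratr r)).
  by rewrite (splitr e) lerD // ltW.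
by apply: ball_triangle qy; exact: ball_sym.
Qed.

Definition consR d (z : R * 'rV[R]_d) : 'rV[R]_(1 + d) :=
  row_mx (\row_(_ < 1) z.1) z.2.

Lemma measurable_consR d : measurable_fun setT
  (@consR d : measurableTypeR R * borelRd R d -> borelRd R (1 + d)).
Proof.
apply: (@measurability _ _ (measurableTypeR R * borelRd R d)%type (borelRd R (1 + d)) setT (@consR d) (@open 'rV[R]_(1 + d))) => //.
move=> _ [U oU <-]; rewrite setTI (open_ratball oU) preimage_bigcup.
rewrite bigcup_mkcond; apply: countable_bigcupT_measurable.
  exact: countableP.
move=> c; case: ifP => // _; have [r0|r0] := ltP 0 (ratr c.2 : R); last first.
  rewrite (_ : _ @^-1` _ = set0) // -subset0 => z [+ _].
  by rewrite ltNge r0.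
rewrite (_ : _ @^-1` _ =
  ball (ratr (c.1 0 0) : R) (ratr c.2) `*`
  ball (rsubmx (map_mx (@ratr R) c.1)) (ratr c.2)).
  apply: measurableX; first exact: measurable_ball.
  by apply: borelRd_open; exact: ball_open.
apply/seteqP; split => [z [_ h]|z [/= h1 [_ h2]]].
  split; rewrite /=.
    have := h 0 (lshift d 0); rewrite row_mxEl !mxE.
    by rewrite (_ : lshift d 0 = 0) //; exact/val_inj.
  by split=> // i j; have := h i (rshift 1 j); rewrite row_mxEr !mxE.
split=> // i j; rewrite /consR; case: (split_ordP j) => k ->.
  rewrite row_mxEl !mxE (ord1 i) (ord1 k).
  by rewrite (_ : lshift d 0 = 0) //; exact/val_inj.
by rewrite row_mxEr; have := h2 i k; rewrite !mxE.
Qed.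

Lemma measurable_coord0 d : measurable_fun setT
  ((fun x => x 0 0) : borelRd R (1 + d) -> measurableTypeR R).
Proof.
apply: (@measurability _ _ (borelRd R (1 + d)) (measurableTypeR R) setT
  (fun x : 'rV[R]_(1 + d) => x 0 0) (@RGenOpens.G R)).
  exact: RGenOpens.measurableE.
move=> _ [_ [a [b ->]] <-]; rewrite setTI; apply: borelRd_open.
by apply: open_comp => [x _|]; [exact: coord_continuous|exact: itv_open].
Qed.

Lemma measurable_rsubmx d : measurable_fun setT
  (rsubmx : borelRd R (1 + d) -> borelRd R d).
Proof.
apply: continuous_borelRd => x A /nbhs_ballP[e /= e0 eA].
apply/nbhs_ballP; exists e => // y [_ xy]; apply: eA; split=> // i j.
by rewrite !mxE; exact: xy.
Qed.

Lemma consRK d (z : R * 'rV[R]_d) :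
  (consR z 0 0, rsubmx (consR z)) = z.
Proof.
case: z => t y; rewrite /consR /= row_mxKr; congr pair.
rewrite -[LHS](_ : row_mx (\row_(_ < 1) t) y 0 (lshift d 0) = _).
  by rewrite row_mxEl mxE.
by congr fun_of_matrix; exact/val_inj.
Qed.

Section step.
Local Open Scope ereal_scope.
Variables (d : nat) (mu : {sigma_finite_measure set (borelRd R d) -> \bar R}).

Definition lebesgue_step : set (borelRd R (1 + d)) -> \bar R :=
  pushforward (lebesgue_measure \x mu)
    (@consR d : measurableTypeR R * borelRd R d -> borelRd R (1 + d)).

HB.instance Definition _ := Measure.copy lebesgue_step
  (measure_function_pushforward__canonical__measure_function_Measure
    (lebesgue_measure \x mu)%E (@measurable_consR d)).

Lemma lebesgue_stepE (A : set (measurableTypeR R)) (B : set (borelRd R d)) :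
  measurable A -> measurable B ->
  lebesgue_step [set x : 'rV[R]_(1 + d) | A (x 0%R 0%R) /\ B (rsubmx x)] = lebesgue_measure A * mu B.
Proof.
move=> mA mB; rewrite -product_measure1E // /lebesgue_step /pushforward.
congr ((_ \x _) _); apply/seteqP.
by split=> -[t y] /=; have [-> ->] := consRK (t, y).
Qed.

Let step_sigma_finite : sigma_finite setT lebesgue_step.
Proof.
have /sigma_finiteP[F [TF ndF Foo]] := sigma_finiteT (@lebesgue_measure R).
have /sigma_finiteP[G [TG ndG Goo]] := sigma_finiteT mu.
exists (fun n => [set x : 'rV[R]_(1 + d) | F n (x 0%R 0%R) /\ G n (rsubmx x)]).
  apply/esym; rewrite -subTset => x _.
  have [n _ Fn] : (\bigcup_n F n) (x 0%R 0%R) by rewrite -TF.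
  have [k _ Gk] : (\bigcup_n G n) (rsubmx x) by rewrite -TG.
  exists (maxn n k) => //; split.
  - exact: ((subsetPset _ _ (ndF _ _ (leq_maxl n k))) _ Fn).
  - exact: ((subsetPset _ _ (ndG _ _ (leq_maxr n k))) _ Gk).
move=> k; have [? ?] := Foo k; have [? ?] := Goo k; split.
  apply: measurableI.
    have : measurable (setT `&` (fun x : borelRd R (1 + d) => x 0%R 0%R) @^-1` F k).
      exact: measurable_coord0.
    by rewrite setTI.
  have : measurable (setT `&` (@rsubmx R 1 1 d : borelRd R (1 + d) -> _) @^-1` G k).
    exact: measurable_rsubmx.
  by rewrite setTI.
by rewrite lebesgue_stepE // lte_mul_pinfty// ge0_fin_numE.
Qed.

HB.instance Definition _ := Measure_isSigmaFinite.Build _ _ _ lebesgue_step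
  step_sigma_finite.

End step.

(* The [d]-dimensional Lebesgue measure on Borel sets, as a [d]-fold product. *)
Fixpoint lebesgueRd d : {sigma_finite_measure set (borelRd R d) -> \bar R} :=
  if d is d'.+1 then lebesgue_step (lebesgueRd d')
  else @dirac _ (borelRd R 0) 0 R.

Definition box d (a b : 'rV[R]_d) : set 'rV[R]_d :=
  [set x | forall i, a 0 i <= x 0 i <= b 0 i].

Lemma measurable_box d (a b : 'rV[R]_d) :
  measurable (box a b : set (borelRd R d)).
Proof.
suff cbox : closed (box a b).
  rewrite -[X in measurable X]setCK.
  apply: measurableC; apply: borelRd_open; exact: closed_openC.
have -> : box a b =
    \bigcap_i ((fun x : 'rV[R]_d => x 0 i) @^-1` `[a 0 i, b 0 i]%classic).
  apply/seteqP; split => x /= h i; first by move=> _ /=; rewrite in_itv /= h.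
  by have := h i Logic.I; rewrite /= in_itv.
apply: closed_bigI => i _; apply: closed_comp => [x _|].
  exact: coord_continuous.
exact: itv_closed.
Qed.

Lemma lebesgueRd_box d (a b : 'rV[R]_d) : (forall i, a 0 i <= b 0 i) ->
  lebesgueRd d (box a b) = (\prod_i (b 0 i - a 0 i))%:E.
Proof.
elim: d => [|d IH] in a b *.
  move=> _; rewrite big_ord0 /= -[RHS](@diracT _ (borelRd R 0) R 0).
  by congr (dirac _ _); apply/seteqP; split => // x _ [].
move=> ab; have e0 : lshift d (0 : 'I_1) = ord0 by exact/val_inj.
have es (i : 'I_d) : rshift 1 i = lift ord0 i by exact/val_inj.
pose a' : 'rV[R]_d := rsubmx (a : 'rV[R]_(1 + d)).
pose b' : 'rV[R]_d := rsubmx (b : 'rV[R]_(1 + d)).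
transitivity (lebesgue_step (lebesgueRd d)
    [set x : 'rV[R]_(1 + d) | `[a 0 ord0, b 0 ord0]%classic (x 0 0) /\ box a' b' (rsubmx x)]).
  rewrite -[LHS]/(lebesgue_step (lebesgueRd d) _).
  congr (lebesgue_step _ _); apply/seteqP; split => x /=.
    by move=> h; split => [|i]; rewrite ?in_itv /= ?mxE.
  move=> [+ h] i; rewrite in_itv /= => h0.
  by case: (unliftP ord0 i) => [j|] -> //; have := h j; rewrite !mxE es.
rewrite lebesgue_stepE; first last.
- exact: measurable_box.
- exact: measurable_itv.
rewrite IH => [|i]; last by rewrite !mxE.
rewrite lebesgue_measure_itv /= lte_fin big_ord_recl.
under eq_bigr do rewrite !mxE es.
case: ltP => [//|ba].
by rewrite (@le_anti _ _ (a 0 ord0) (b 0 ord0)) ?ab // subrr mul0r mul0e.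
Qed.

End lebesgue.

(* Bounded E-valued Radon measures with E = R^m: [m]-tuples of finite signed
   measures. On R^d and on the torus every finite Borel measure is Radon. *)
Definition vmeasure (R : realType) disp (T : measurableType disp) (m : nat) :=
  'I_m -> {charge set T -> \bar R}.

Section integration.
Context disp (T : measurableType disp) (R : realType).
Implicit Types (nu : {charge set T -> \bar R}) (D : set T).

Definition hahn_pos nu : set T := projT1 (cid (Hahn_decomposition nu)).

Definition hahn_neg nu : set T :=
  projT1 (cid (projT2 (cid (Hahn_decomposition nu)))).

Definition hahn_posneg nu : hahn_decomposition nu (hahn_pos nu) (hahn_neg nu) :=
  projT2 (cid (projT2 (cid (Hahn_decomposition nu)))).

(* Independent of the chosen Hahn decomposition ([Hahn_decomposition_uniq]). *)
Definition charge_integral nu D (f : T -> R) : R :=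
  Rintegral (jordan_pos (hahn_posneg nu)) D f -
  Rintegral (jordan_neg (hahn_posneg nu)) D f.

Definition vintegral m (mu : vmeasure R T m) D (f : T -> R) : 'cV[R]_m :=
  \col_i charge_integral (mu i) D f.

Definition dot_integral m (mu : vmeasure R T m) D (g : T -> 'cV[R]_m) : R :=
  \sum_i charge_integral (mu i) D (fun x => g x i 0).

End integration.

Definition concentrated (R : realType) disp (T : measurableType disp) m
    (mu : vmeasure R T m) (D : set T) :=
  forall i B, measurable B -> B `&` D = set0 -> mu i B = 0%E.

Section torus.
Variables (R : realType) (d : nat).

Definition lattice_eq (x y : 'rV[R]_d) : bool :=
  [forall i, (x 0 i - y 0 i) \is a Num.int].

Lemma lattice_eq_refl : reflexive lattice_eq.
Proof. by move=> x; apply/forallP => i; rewrite subrr rpred0. Qed.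

Lemma lattice_eq_sym : symmetric lattice_eq.
Proof. by move=> x y; apply: eq_forallb => i; rewrite -rpredN opprB. Qed.

Lemma lattice_eq_trans : transitive lattice_eq.
Proof.
move=> y x z /forallP xy /forallP yz; apply/forallP => i.
by rewrite -(subrKA (y 0 i)) rpredD.
Qed.

Canonical lattice_equiv :=
  EquivRel lattice_eq lattice_eq_refl lattice_eq_sym lattice_eq_trans.

Definition torus : Type := quotient_topology {eq_quot lattice_eq}.
HB.instance Definition _ := PointedTopological.on torus.
HB.instance Definition _ := Quotient.on torus.

Definition torus_pi (x : 'rV[R]_d) : torus := \pi_torus x.

End torus.

Section diff.
Variables (R : realType) (d : nat).

Definition partial (V : normedModType R) (i : 'I_d) (f : 'rV[R]_d -> V) :
  'rV[R]_d -> V := fun x => 'D_(delta_mx 0 i) f x.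

Definition smooth (V : normedModType R) (f : 'rV[R]_d -> V) :=
  forall s : seq 'I_d, let g := foldr (@partial V) f s in
    continuous g /\ forall x i, derivable g x (delta_mx 0 i).

(* Multi-indices of order at most [k], as exponent vectors. *)
Definition multi_index (k : nat) : finType := {ffun 'I_d -> 'I_k.+1}.

Definition mi_order k (al : multi_index k) : nat := (\sum_i al i)%N.

Definition mderiv (V : normedModType R) k (al : multi_index k)
    (f : 'rV[R]_d -> V) : 'rV[R]_d -> V :=
  foldr (fun i g => iter (al i) (@partial V i) g) f (enum 'I_d).

Definition test_fun (n : nat) (Omega : set 'rV[R]_d)
    (phi : 'rV[R]_d -> 'cV[R]_n) :=
  let supp := closure [set x | phi x != 0] in
  [/\ smooth phi, compact supp & supp `<=` Omega].

End diff.

Section operators.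
Variables (R : realType) (d m n k : nat).
Implicit Types (A : multi_index d k -> 'M[R]_(n, m)) (Omega : set 'rV[R]_d).

(* The formal adjoint [phi |-> (-1)^k sum_(|al| = k) A_al^T d^al phi]; only the
   coefficients [A al] with [|al| = k] are used. *)
Definition adjoint_op A (phi : 'rV[R]_d -> 'cV[R]_n) : 'rV[R]_d -> 'cV[R]_m :=
  fun x => (-1) ^+ k *:
    \sum_(al : multi_index d k | mi_order al == k) (A al)^T *m mderiv al phi x.

Definition diffop A Omega (mu : vmeasure R (borelRd R d) m)
    (phi : 'rV[R]_d -> 'cV[R]_n) : R :=
  dot_integral mu Omega (adjoint_op A phi).

Definition enorm (v : 'cV[R]_n) : R := Num.sqrt (\sum_i v i 0 ^+ 2).

Definition sobolev_norm (q : R) Omega (phi : 'rV[R]_d -> 'cV[R]_n) : \bar R :=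
  ((\sum_(al : multi_index d k | (mi_order al <= k)%N)
      \int[lebesgueRd R d]_(x in Omega) (enorm (mderiv al phi x) `^ q)%:E)
   `^ q^-1)%E.

(* Norm of [W^{-k,p}(Omega; R^n)], the dual of [W_0^{k,p'}(Omega; R^n)], on
   distributions [T]: test functions suffice because they are dense in
   [W_0^{k,p'}], and [T] belongs to [W^{-k,p}] iff the value is finite. *)
Definition dual_sobolev_norm (p : R) Omega
    (T : ('rV[R]_d -> 'cV[R]_n) -> R) : \bar R :=
  ereal_sup [set `|T phi|%:E | phi in [set phi |
    test_fun Omega phi /\ (sobolev_norm (p / (p - 1)) Omega phi <= 1)%E]].

Definition asymptotically_free A (p : R) Omega
    (mu : nat -> vmeasure R (borelRd R d) m) :=
  dual_sobolev_norm p Omega (diffop A Omega (mu j)) @[j --> \oo] --> 0%E.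

(* Functions on the torus are differentiated through their periodic lifts; the
   result is periodic, so its value at [repr xi] does not depend on [repr]. *)
Definition torus_free A (theta : vmeasure R (borel (torus R d)) m) :=
  forall psi : torus R d -> 'cV[R]_n, smooth (psi \o @torus_pi R d) ->
  dot_integral theta setT
    (fun xi => adjoint_op A (psi \o @torus_pi R d) (repr xi)) = 0.

End operators.

Section two_scale.
Variables (R : realType) (d m : nat).
Variable lambda : {finite_measure set (borelRd R d) -> \bar R}.
Implicit Types (D Omega : set 'rV[R]_d).
Implicit Type theta : 'rV[R]_d -> vmeasure R (borel (torus R d)) m.

(* Its measurable sets are the lambda-measurable sets, i.e. the
   lambda-completion of the Borel sigma-algebra. *)
Definition completedRd : measurableType _ := caratheodory_type (lambda^*)%mu.

Definition completion : {measure set completedRd -> \bar R} :=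
  @completed_measure_extension _ _ R lambda.

Definition weak_star_measurable D theta :=
  forall i (B : set (borel (torus R d))), measurable B ->
  measurable_fun (D : set completedRd) (fun x : completedRd => theta x i B).

(* The first clause says that the limit integral exists. *)
Definition two_scale_cvg Omega (eps : nat -> R)
    (mu : nat -> vmeasure R (borelRd R d) m) theta :=
  forall Psi : 'rV[R]_d * torus R d -> R,
    {within closure Omega `*` setT, continuous Psi} ->
  let inner (x : completedRd) : 'cV[R]_m :=
    vintegral (theta x) setT (fun xi => Psi (x, xi)) in
  (forall i, completion.-integrable
     (closure Omega : set completedRd) (fun x => (inner x i 0)%:E)) /\
  vintegral (mu j) Omega (fun x => Psi (x, torus_pi ((eps j)^-1 *: x)))
    @[j --> \oo] -->
  \col_i Rintegral completion
     (closure Omega : set completedRd) (fun x => inner x i 0).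

End two_scale.

(* Main.v *)
Require Import Defs.
From mathcomp Require Import all_boot all_order all_algebra.
From mathcomp Require Import all_classical all_reals all_analysis.
From mathcomp Require Import measurable_realfun ring lra.
Import Order.TTheory GRing.Theory Num.Theory.
Import numFieldNormedType.Exports.
Local Open Scope classical_set_scope.
Local Open Scope ring_scope.

(* Test [A mu_eps] with [eps^k phi(x) psi(x / eps)], where [phi] is a cut-off
   supported in Omega and [psi] is smooth on the torus. By the Leibniz rule a
   derivative of order [s <= k] of [phi(x) psi(x / eps)], multiplied by [eps^s],
   is [phi(x) (d^s psi)(x / eps)] up to [eps] times a combination of terms
   [eps^a u(x) v(x / eps)]. Hence these test functions are bounded in
   [W^{k,p'}], and the pairing tends to [0]. On the other hand, two-scale
   convergence identifies the limit of the pairing (the remainder is a bounded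
   sequence times [eps]), which gives
     [int phi(x) (int A^* psi dtheta_x) dlambda(x) = 0].
   Letting [phi] approximate indicators of boxes, the inner integral vanishes
   for lambda-almost every [x] in Omega; the exceptional set is made independent
   of [psi] by separability of the set of all [A^* psi] in the uniform norm. *)

Set Implicit Arguments.
Unset Strict Implicit.
Unset Printing Implicit Defensive.

(** * Smooth functions *)

(** The total variations of the [mu j] are never estimated. What controls the remainder is that it
    is built from the class [two_scale_sum], chosen before the scale: up to nonnegative powers of
    [eps], its members are combinations of admissible two-scale test functions, so their integrals
    converge, and a convergent sequence times [eps j] tends to [0]. The same class is bounded
    uniformly for scales below a given one, which serves the Sobolev bound. Test functions must have
    compact support in Omega, whereas the limit lives on its closure: hence only boxes inside Omega
    are tested, and the conclusion concerns points of Omega. Since [theta] is only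
    lambda-measurable, integrals are taken for the completion of lambda; Borel hulls carry the
    vanishing of integrals from Borel sets to completed ones and enclose completed null sets in
    Borel null sets. *)

Section smooth_calculus.
Variables (R : realType) (d : nat).
Implicit Types (V : normedModType R) (i : 'I_d) (s : seq 'I_d).
Local Notation E := 'rV[R]_d.
Local Notation unitv i := (delta_mx 0 i : E).

(** [smooth] speaks of all iterated partials at once; grading by the order peels off the partial
    applied first, so that stability under products and dilations follows by induction on [n]. The
    passage is [smooth_Cn]. *)
Fixpoint Cn (n : nat) V (f : E -> V) : Prop :=
  if n is n'.+1 then [/\ continuous f,
    forall x i, derivable f x (unitv i) & forall i, Cn n' (partial i f)]
  else continuous f.

Lemma CnS n V (f : E -> V) : Cn n.+1 f <-> [/\ continuous f,
  forall x i, derivable f x (unitv i) & forall i, Cn n (partial i f)].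
Proof. by []. Qed.

Lemma CnW n V (f : E -> V) : Cn n.+1 f -> Cn n f.
Proof.
elim: n f => [|n IH] f /CnS[cf df pf] //.
by apply/CnS; split => // i; exact: IH.
Qed.

Lemma smooth_partial V (f : E -> V) i : smooth f -> smooth (partial i f).
Proof. by move=> sf s; have := sf (rcons s i); rewrite foldr_rcons. Qed.

Lemma smooth_Cn V (f : E -> V) : smooth f <-> forall n, Cn n f.
Proof.
split=> [sf n|].
  elim: n f sf => [|n IH] f sf; have [cf df] := sf [::] => //.
  by split=> // i; exact/IH/smooth_partial.
move=> Cf s; elim/last_ind: s f Cf => [|s i IH] f Cf /=.
  by have [cf df _] := Cf 1%N; split.
by rewrite foldr_rcons; apply: IH => n; have [_ _] := Cf n.+1; exact.
Qed.

Lemma smooth_continuous V (f : E -> V) : smooth f -> continuous f.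
Proof. by move=> sf; have [] := sf [::]. Qed.

Lemma smooth_derivable V (f : E -> V) x i :
  smooth f -> derivable f x (unitv i).
Proof. by move=> sf; have [_] := sf [::]; exact. Qed.

Lemma smooth_foldr V (f : E -> V) s : smooth f ->
  smooth (foldr (@partial R d V) f s).
Proof. by move=> sf; elim: s => //= i s IH; exact: smooth_partial. Qed.

Lemma partialD V (f g : E -> V) i :
  (forall x, derivable f x (unitv i)) -> (forall x, derivable g x (unitv i)) ->
  partial i (f \+ g) = partial i f \+ partial i g.
Proof. by move=> df dg; apply/funext => x; exact: deriveD. Qed.

Lemma CnD n V (f g : E -> V) : Cn n f -> Cn n g -> Cn n (f \+ g).
Proof.
elim: n f g => [|n IH] f g; first by move=> cf cg x; exact: cvgD (cf x) (cg x).
move=> /CnS[cf df pf] /CnS[cg dg pg]; apply/CnS; split=> [x|x i|i].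
- exact: cvgD (cf x) (cg x).
- exact: derivableD.
- by rewrite partialD //; exact: IH.
Qed.

Lemma CnZl n V (f : E -> V) (a : R) : Cn n f -> Cn n (fun x => a *: f x).
Proof.
elim: n f => [|n IH] f; first by move=> cf x; exact: cvgZr (cf x).
move=> /CnS[cf df pf]; apply/CnS; split=> [x|x i|i].
- exact: cvgZr (cf x).
- exact: derivableZ.
rewrite (_ : partial i _ = (fun x => a *: partial i f x)); first exact: IH.
by apply/funext => x; exact: deriveZ.
Qed.

Lemma Cn_cst n V (c : V) : Cn n (fun _ : E => c).
Proof.
elim: n V c => [|n IH] V c; first exact: cst_continuous.
apply/CnS; split=> [|x i|i]; [exact: cst_continuous|exact: derivable_cst|].
rewrite (_ : partial i _ = (fun=> 0)); first exact: IH.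
by apply/funext => x; rewrite /partial derive_cst.
Qed.

Lemma CnM n (f g : E -> R) : Cn n f -> Cn n g -> Cn n (f \* g).
Proof.
elim: n f g => [|n IH] f g; first by move=> cf cg x; exact: cvgM (cf x) (cg x).
move=> Cf Cg; move: (Cf) (Cg) => /CnS[cf df pf] /CnS[cg dg pg].
apply/CnS; split=> [x|x i|i]; [exact: cvgM (cf x) (cg x)|exact: derivableM|].
rewrite (_ : partial i _ = (f \* partial i g) \+ (g \* partial i f)).
  by apply: CnD; apply: IH => //; exact: CnW.
by apply/funext => x; exact: deriveM.
Qed.

Lemma derivable_scale m (f : E -> R) (g : E -> 'cV[R]_m) x v :
  derivable f x v -> derivable g x v -> derivable (fun y => f y *: g y) x v.
Proof.
move=> df /derivable_mxP dg; apply/derivable_mxP => i j.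
rewrite (_ : (fun _ => _) = f * (fun y => g y i j)).
  exact (derivableM df (dg i j)).
by apply/funext => y; rewrite mxE.
Qed.

Lemma derive_scale m (f : E -> R) (g : E -> 'cV[R]_m) x v :
  derivable f x v -> derivable g x v ->
  'D_v (fun y => f y *: g y) x = f x *: 'D_v g x + 'D_v f x *: g x.
Proof.
move=> df dg; have := dg => /derivable_mxP dg'.
rewrite derive_mx; last exact: derivable_scale.
apply/matrixP => i j; rewrite !mxE derive_mx // mxE.
rewrite (_ : (fun _ => _) = f * (fun y => g y i j)).
  by rewrite (deriveM df (dg' i j)); congr (_ + _); rewrite mulrC.
by apply/funext => y; rewrite mxE.
Qed.

Lemma CnZ n m (f : E -> R) (g : E -> 'cV[R]_m) :
  Cn n f -> Cn n g -> Cn n (fun y => f y *: g y).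
Proof.
elim: n f g => [|n IH] f g; first by move=> cf cg x; exact: cvgZ (cf x) (cg x).
move=> Cf Cg; move: (Cf) (Cg) => /CnS[cf df pf] /CnS[cg dg pg].
apply/CnS; split=> [x|x i|i].
- exact: cvgZ (cf x) (cg x).
- exact: derivable_scale.
rewrite (_ : partial i _ =
    (fun x => f x *: partial i g x) \+ (fun x => partial i f x *: g x)).
  by apply: CnD; apply: IH => //; exact: CnW.
by apply/funext => x; exact: derive_scale.
Qed.

(** Only derivability along [v] is assumed, so no chain rule for differentials applies. The
    difference quotient of [f] is taken at step [a * h] and multiplied by [a]; [a != 0] keeps that
    step in the punctured neighbourhood. *)
Lemma is_derive_dilate V (f : E -> V) (a : R) x v : a != 0 ->
  derivable f (a *: x) v ->
  is_derive x v (fun y => f (a *: y)) (a *: 'D_v f (a *: x)).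
Proof.
move=> a0 df; pose q h := h^-1 *: (f (h *: v + a *: x) - f (a *: x)).
have ah : a * h @[h --> 0^'] --> (0 : R)^'.
  move=> P /nbhs_ballP[e /= e0 eP]; apply/nbhs_ballP.
  exists (e / `|a|); first by rewrite /= divr_gt0 // normr_gt0.
  move=> h /=; rewrite /ball /= !sub0r !normrN ltr_pdivlMr ?normr_gt0 // => he
    h0.
  apply: eP; last by rewrite mulf_neq0.
  by rewrite /ball /= sub0r normrN normrM mulrC.
have ql : q (a * h) @[h --> 0^'] --> 'D_v f (a *: x).
  by apply: cvg_comp ah _; exact: df.
have {}ql : h^-1 *: (f (a *: (h *: v + x)) - f (a *: x)) @[h --> 0^']
    --> a *: 'D_v f (a *: x).
  apply: cvg_trans (cvgZr (k := a) ql); apply: near_eq_cvg; near=> h.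
  rewrite /q /= scalerA invfM mulrA divff // mul1r; congr (_ *: (f _ - _)).
  by rewrite scalerDr scalerA.
apply: DeriveDef; [apply: cvgP; exact: ql|exact: cvg_lim].
Unshelve. all: by end_near. Qed.

Lemma Cn_dilate n V (f : E -> V) (a : R) : a != 0 ->
  Cn n f -> Cn n (fun y => f (a *: y)).
Proof.
move=> a0; have ca : continuous ( *:%R a : E -> E).
  by move=> x; exact: cvgZr cvg_id.
elim: n f => [|n IH] f.
  by move=> cf x; apply: continuous_comp; [exact: ca|exact: cf].
move=> /CnS[cf df pf]; apply/CnS; split=> [x|x i|i].
- by apply: continuous_comp; [exact: ca|exact: cf].
- by have [] := is_derive_dilate a0 (df (a *: x) i).
rewrite (_ : partial i _ = (fun x => a *: partial i f (a *: x))).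
  apply: (@CnZl n V); exact: IH.
by apply/funext => x; have /@derive_val := is_derive_dilate a0 (df (a *: x) i);
  exact.
Qed.
End smooth_calculus.

(** * Flat exponentials, box bumps, and open boxes as generators of the Borel sets *)

Section flat_exp.
Variable R : realType.

(* The family in [j] spans a space stable under differentiation, which gives
   smoothness by induction. *)
Definition flat_exp (j : nat) (t : R) : R :=
  if t <= 0 then 0 else expR (- t^-1) * t^-1 ^+ j.

Lemma flat_exp_le0 j t : t <= 0 -> flat_exp j t = 0.
Proof. by rewrite /flat_exp => ->. Qed.

Lemma flat_exp_gt0 j t : 0 < t -> flat_exp j t = expR (- t^-1) * t^-1 ^+ j.
Proof. by rewrite /flat_exp leNgt => ->. Qed.

(** For [t > 0] and [s = t^-1] this is [s ^ (j + 1) <= (j + 1)! * exp s], one term of the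
    exponential series. It gives the limit [0] at [0], and from there the derivative at [0]. *)
Lemma flat_exp_linear j t : `|flat_exp j t| <= j.+1`!%:R * `|t|.
Proof.
have [t0|t0] := leP t 0; first by rewrite flat_exp_le0 // normr0 mulr_ge0.
have s0 : 0 < t^-1 by rewrite invr_gt0.
have sj : 0 <= t^-1 ^+ j by rewrite exprn_ge0 // ltW.
rewrite flat_exp_gt0 // ger0_norm ?mulr_ge0 ?expR_ge0 // gtr0_norm //.
rewrite -[leLHS](divfK (lt0r_neq0 t0)) ler_pM2r // -mulrA -exprSr expRN mulrC.
rewrite ler_pdivrMr ?expR_gt0 // -ler_pdivrMl ?ltr0n ?fact_gt0 // mulrC.
by apply: le_trans (expR_ge1Dxn j (ltW s0)); rewrite lerDr.
Qed.

Lemma flat_exp_cvg0 j : flat_exp j h @[h --> 0^'] --> (0 : R).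
Proof.
apply: (@cvg_to_0_linear _ _ (j.+1`!%:R) 1) => // r _; exact: flat_exp_linear.
Qed.

Lemma is_derive_flat_exp j (t : R) :
  is_derive t 1 (flat_exp j) (flat_exp j.+2 t - j%:R * flat_exp j.+1 t).
Proof.
have [t0|t0|->] := ltgtP t 0.
- rewrite !flat_exp_le0 ?ltW // mulr0 subr0.
  apply: (@near_eq_is_derive _ _ _ (cst 0)) => //.
  near=> x; rewrite flat_exp_le0 //; apply: ltW; near: x.
  exact: lt_nbhsl.
- rewrite !flat_exp_gt0 //.
  apply: (@near_eq_is_derive R R R (fun x : R => expR (- x^-1) * x^-1 ^+ j)).
  + near=> x; rewrite flat_exp_gt0 //; near: x.
    exact: lt_nbhsr.
  + have dV : is_derive t 1 (fun x : R => x^-1) (- t^-2 *: 1).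
      by apply: is_deriveV; rewrite ?gt_eqF.
    have dE := @is_derive1_comp R expR (- (fun x : R => x^-1))
      t _ _ (is_derive_expR _) (is_deriveN dV).
    have dG := is_deriveM dE (is_deriveX j dV).
    rewrite (_ : (fun x => _) = (expR \o - (fun x : R => x^-1))
      * (fun x : R => x^-1) ^+ j); last first.
      by apply/funext => x; rewrite !fctE.
    apply: (is_derive_eq dG).
    rewrite !fctE /= /GRing.scale /= !mulr1 !exprVn.
    case: j dG => [|j] _ /=; first by field; rewrite gt_eqF.
    by rewrite !exprS; field; rewrite expf_neq0 gt_eqF.
- rewrite !flat_exp_le0 // mulr0 subr0.
  (* The difference quotient at [0] is exactly [flat_exp j.+1 h], on both sides of [0]. *)
  have ql : h^-1 *: (flat_exp j (h *: 1 + 0) - flat_exp j 0) @[h --> 0^']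
    --> (0 : R).
    apply: cvg_trans (flat_exp_cvg0 j.+1); apply: near_eq_cvg; near=> h.
    rewrite [h *: 1]mulr1 addr0 (flat_exp_le0 j (lexx 0)) subr0.
    have [h0|h0] := leP h 0; first by rewrite !flat_exp_le0 // scaler0.
    by rewrite !flat_exp_gt0 // exprSr [h^-1 *: _]mulrC mulrA.
  apply: DeriveDef; [apply: cvgP; exact: ql|exact: cvg_lim].
Unshelve. all: by end_near. Qed.

Lemma flat_exp_continuous j : continuous (flat_exp j).
Proof.
move=> t; apply/differentiable_continuous/derivable1_diffP.
by have /@ex_derive := is_derive_flat_exp j t.
Qed.

End flat_exp.

Section bump.
Variables (R : realType) (d : nat).
Local Notation E := 'rV[R]_d.

(** Turns a directional derivative into a one-variable one, where the chain rule is available. *)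
Lemma is_derive_line (V : normedModType R) (f : E -> V) x v df :
  is_derive (0 : R) 1 (fun h : R => f (h *: v + x)) df -> is_derive x v f df.
Proof.
case=> /cvgP; rewrite /derivable /derive.
set g1 := fun h => h^-1 *: _ => c1 l1.
set g2 := fun h => h^-1 *: ((f \o shift x) (h *: v) - f x).
have E12 : g1 = g2.
  by apply/funext => h; rewrite /g1 /g2 /= addr0 scale0r add0r [_%:A]mulr1.
by apply: DeriveDef; rewrite /derivable /derive -/g2 -E12.
Qed.

Lemma is_derive_coord (g : R -> R) (a b dg : R) (k : 'I_d) (x v : E) :
  is_derive (a * x 0 k + b) 1 g dg ->
  is_derive x v (fun y => g (a * y 0 k + b)) (dg * (a * v 0 k)).
Proof.
move=> dgx; apply: is_derive_line.
rewrite (_ : (fun h => _) = g \o (fun h : R => (a * v 0 k)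
  *: h + (a * x 0 k + b))); last first.
  by apply/funext => h /=; rewrite !mxE /GRing.scale /=; congr g; ring.
have dl : is_derive (0 : R) 1 (fun h : R => (a * v 0 k) *: h + (a * x 0 k + b))
  (a * v 0 k).
  have := is_deriveD (is_deriveZ (a * v 0 k) (is_derive_id (0 : R) 1))
     (is_derive_cst (a * x 0 k + b) (0 : R) 1).
  by rewrite addr0 [_ *: 1]mulr1; exact.
apply: is_derive1_comp; by rewrite scaler0 add0r.
Qed.

Lemma Cn_flat_exp n j (a b : R) (k : 'I_d) :
  Cn n (fun x : E => flat_exp j (a * x 0 k + b)).
Proof.
have cf l : continuous (fun x : E => flat_exp l (a * x 0 k + b)).
  move=> x; apply: (@continuous_comp _ _ _ (fun x : E => a * x 0 k + b));
    last exact: flat_exp_continuous.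
  apply: (@continuous_comp _ _ _ (fun x : E => x 0 k) (fun t => a * t + b)).
    exact: coord_continuous.
  by move=> ?; apply: cvgD; [apply: cvgMr; exact: cvg_id|exact: cvg_cst].
elim: n j => [|n IH] j; first exact: cf.
have df x i := is_derive_coord (delta_mx 0 i)
  (is_derive_flat_exp j (a * (x : E) 0 k + b)).
apply/CnS; split=> [|x i|i]; [exact: cf|by have [] := df x i|].
pose c : R := a * (delta_mx 0 i : E) 0 k.
rewrite (_ : partial i _ = (fun x : E => c *: flat_exp j.+2 (a * x 0 k + b)) \+
    (fun x : E => (- (j%:R * c)) *: flat_exp j.+1 (a * x 0 k + b))).
  by apply: CnD; apply: (@CnZl R d n R); exact: IH.
apply/funext => x; have /@derive_val := df x i; rewrite /partial => ->.
by rewrite /= /GRing.scale /= -/c; ring.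
Qed.

(* [flat_exp 0] is [exp (- 1 / t)], so the product tends to the indicator of the
   open box as [N] tends to infinity. *)
Definition box_bump (a b : E) (N : nat) (x : E) : R :=
  \prod_k (flat_exp 0 (N.+1%:R * (x 0 k - a 0 k)) *
           flat_exp 0 (N.+1%:R * (b 0 k - x 0 k))).

Definition obox (a b : E) : set E := [set x | forall k, a 0 k < x 0 k < b 0 k].

Lemma smooth_box_bump a b N : smooth (box_bump a b N).
Proof.
apply/smooth_Cn => n; rewrite /box_bump.
elim: (index_enum _) => [|k s IH].
  rewrite (_ : (fun x => _) = fun=> 1); first exact: Cn_cst.
  by apply/funext => x; rewrite big_nil.
rewrite (_ : (fun x => _) = (fun x : E =>
   flat_exp 0 (N.+1%:R * x 0 k + (- (N.+1%:R * a 0 k)))) \*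
   (fun x => flat_exp 0 ((- N.+1%:R) * x 0 k + N.+1%:R * b 0 k)) \*
   (fun x => \prod_(i <- s) (flat_exp 0 (N.+1%:R * (x 0 i - a 0 i)) *
           flat_exp 0 (N.+1%:R * (b 0 i - x 0 i))))).
  by apply: CnM => //; apply: CnM; exact: Cn_flat_exp.
apply/funext => x; rewrite big_cons /=;
  congr (flat_exp _ _ * flat_exp _ _ * _); ring.
Qed.

Lemma flat_exp0_ge0 (t : R) : 0 <= flat_exp 0 t.
Proof.
have [t0|t0] := leP t 0; first by rewrite flat_exp_le0.
by rewrite flat_exp_gt0 // mulr1 expR_ge0.
Qed.

Lemma flat_exp0_le1 (t : R) : flat_exp 0 t <= 1.
Proof.
have [t0|t0] := leP t 0; first by rewrite flat_exp_le0.
by rewrite flat_exp_gt0 // mulr1 -expR0 ler_expR oppr_le0 invr_ge0 ltW.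
Qed.

Lemma box_bump_ge0 a b N x : 0 <= box_bump a b N x.
Proof. by apply: prodr_ge0 => k _; rewrite mulr_ge0 // flat_exp0_ge0. Qed.

Lemma box_bump_le1 a b N x : box_bump a b N x <= 1.
Proof.
apply: prodr_ile1 => k _; rewrite mulr_ge0 ?flat_exp0_ge0 //=.
by rewrite mulr_ile1 ?flat_exp0_ge0 ?flat_exp0_le1.
Qed.

Lemma box_bump_out a b N x : ~ obox a b x -> box_bump a b N x = 0.
Proof.
move=> /existsNP[k /negP]; rewrite negb_and -!leNgt => h.
have N0 : 0 < N.+1%:R :> R by [].
rewrite /box_bump (bigD1 k) //=; case/orP: h => h.
  by rewrite (flat_exp_le0 _ (t :=
    _ * (_ - a 0 k))) ?mul0r // pmulr_rle0 // subr_le0.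
by rewrite (flat_exp_le0 _ (t :=
  _ * (b 0 k - _))) ?mulr0 ?mul0r // pmulr_rle0 // subr_le0.
Qed.

Lemma box_bump_cvg a b x : obox a b x ->
  box_bump a b N x @[N --> \oo] --> (1 : R).
Proof.
move=> xab.
have fl (t : R) : 0 < t -> flat_exp 0 (N.+1%:R * t) @[N --> \oo] --> (1 : R).
  move=> t0; rewrite (_ : (fun _ => _)
    = (fun N => expR (- (t^-1 * N.+1%:R^-1)))).
    rewrite [X in _ --> X](_ : 1 = expR (- (t^-1 * 0)));
      last by rewrite mulr0 oppr0 expR0.
    apply: continuous_cvg; first exact: continuous_expR.
    by apply: cvgN; apply: cvgMr; exact: cvg_harmonic.
  apply/funext => N; rewrite flat_exp_gt0 ?mulr_gt0 // expr0 mulr1.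
  by rewrite invfM mulrC.
rewrite /box_bump; elim: (index_enum _) => [|k s IH].
  by under eq_fun do rewrite big_nil; exact: cvg_cst.
under eq_fun do rewrite big_cons.
have /andP[xa xb] := xab k; rewrite -subr_gt0 in xa; rewrite -subr_gt0 in xb.
by have := cvgM (cvgM (fl _ xa) (fl _ xb)) IH; rewrite !mulr1; exact.
Qed.

Definition oboxes : set (set E) := [set A | exists a b, A = obox a b].

Lemma oboxI (a b a' b' : E) : obox a b `&` obox a' b' =
  obox (\row_i Num.max (a 0 i) (a' 0 i)) (\row_i Num.min (b 0 i) (b' 0 i)).
Proof.
apply/seteqP; split=> [x [/= h1 h2] i|x /= h].
  move: (h1 i) (h2 i) => /andP[u1 u2] /andP[v1 v2].
  by rewrite !mxE gt_max lt_min u1 u2 v1 v2.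
split=> i; have := h i; rewrite !mxE gt_max lt_min.
  by move=> /andP[/andP[u1 u2] /andP[v1 v2]]; rewrite u1 v1.
by move=> /andP[/andP[u1 u2] /andP[v1 v2]]; rewrite u2 v2.
Qed.

Lemma ratball_obox (c : 'rV[rat]_d * rat) : exists a b : E, 0 < ratr c.2 :> R ->
  @ratball R d c = obox a b.
Proof.
pose q := map_mx (@ratr R) c.1.
exists (\row_i (q 0 i - ratr c.2)), (\row_i (q 0 i + ratr c.2)) => r0.
apply/seteqP; split=> [x [_ h] i|x /= h].
  by have := h 0 i; rewrite /ball /= distrC ltr_distl !mxE.
split=> // j i; have := h i; rewrite (ord1 j) /ball /= distrC ltr_distl !mxE.
exact.
Qed.

(** Open sets are countable unions of rational balls, and a ball of the sup norm is an open box. *)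
Lemma borel_oboxes (A : set (borelRd R d)) : measurable A -> <<s oboxes >> A.
Proof.
move: A; apply: smallest_sub; first exact: smallest_sigma_algebra.
move=> U oU; rewrite (open_ratball oU) bigcup_mkcond.
apply: (@countable_bigcupT_measurable _ (g_sigma_algebraType oboxes)).
  exact: countableP.
move=> c; case: ifP => // _; have [a [b ab]] := ratball_obox c.
have [r0|r0] := ltP 0 (ratr c.2 : R).
  by rewrite ab //; apply: sub_sigma_algebra; exists a, b.
rewrite (_ : ratball _ = set0) // -subset0 => x [+ _].
by rewrite ltNge r0.
Qed.

Lemma open_obox (a b : E) : open (obox a b).
Proof.
rewrite openE => x xab.
suff H : \forall y \near x, forall k, a 0 k < (y : E) 0 k < b 0 k by exact: H.
apply: (@filter_forall _ _ (fun k (y : E) => a 0 k < y 0 k < b 0 k)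
  (nbhs (x : E)) (nbhs_filter (x : E))) => k;
  have : nbhs (x 0 k) `]a 0 k, b 0 k[%classic.
  apply: open_nbhs_nbhs; split; first exact: itv_open.
  by rewrite /= in_itv /=; exact: xab.
by move=> /coord_continuous;
  apply: (@filterS _ _ (nbhs_filter (x : E))) => y /=; rewrite in_itv.
Qed.

Lemma box_sub (a b a' b' : E) : (forall i, a' 0 i <= a 0 i) ->
  (forall i, b 0 i <= b' 0 i) -> box a b `<=` box a' b'.
Proof.
move=> aa bb x h i; move: (h i) => /andP[h1 h2].
by rewrite (le_trans (aa i) h1) (le_trans h2 (bb i)).
Qed.

End bump.

(** * Localization of the limit measure *)

Section completion.
Variables (R : realType) (d : nat).
Variable lambda : {finite_measure set (borelRd R d) -> \bar R}.
Local Notation E := 'rV[R]_d.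
Local Notation clambda := (completion lambda).
Local Notation T := (completedRd lambda).

Lemma completed_measurable (A : set E) :
  measurable (A : set (borelRd R d)) -> measurable (A : set T).
Proof. exact: caratheodory_measurable_mu_ext. Qed.

Lemma completionE (A : set E) :
  measurable (A : set (borelRd R d)) -> clambda A = lambda A.
Proof. exact: measurable_mu_extE. Qed.

Lemma completion_fin (A : set E) : measurable (A : set T) ->
  clambda A \is a fin_num.
Proof.
move=> mA; rewrite ge0_fin_numE //; apply: (@le_lt_trans _ _ (clambda setT)).
  by apply: le_measure; rewrite ?inE.
rewrite completionE //.
by rewrite ltey_eq fin_num_measure.
Qed.

(** The outer measure is an infimum over countable Borel covers. It is finite, so there are covers
    with excess at most [1 / (n + 1)], and the intersection of their unions attains it. *)
Lemma measurable_hull (X : set E) : exists B : set (borelRd R d),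
  [/\ measurable B, X `<=` B & lambda B = ((lambda^*)%mu X)].
Proof.
have Xfin : ((lambda^*)%mu X) \is a fin_num.
  rewrite ge0_fin_numE; last exact: mu_ext_ge0.
  apply: (@le_lt_trans _ _ ((lambda^*)%mu setT)); first exact: le_mu_ext.
  rewrite measurable_mu_extE //.
  by rewrite ltey_eq fin_num_measure.
have /choice[B HB] n : exists B : set (borelRd R d),
    [/\ measurable B, X `<=` B &
    (lambda B <= (lambda^*)%mu X + (n.+1%:R^-1)%:E)%E].
  have n0 : 0 < n.+1%:R^-1 :> R by [].
  have [_ [A [mA XA] <-] hA] := lb_ereal_inf_adherent n0 Xfin.
  exists (\bigcup_k A k); split => //; first exact: bigcupT_measurable.
  by apply: le_trans (ltW hA); apply: measure_sigma_subadditive => //;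
    exact: bigcupT_measurable.
have mB n : measurable (B n) by have [] := HB n.
exists (\bigcap_n B n); split.
- exact: bigcapT_measurable.
- by move=> x Xx n _; have [_ + _] := HB n; exact.
apply/eqP; rewrite eq_le; apply/andP; split.
  apply/lee_addgt0Pr => e e0.
  have [n _ ne] := near_infty_natSinv_lt (PosNum e0).
  have [_ _ h] := HB n.
  apply: (@le_trans _ _ (lambda (B n))).
    apply: le_measure; rewrite ?inE //; first exact: bigcapT_measurable.
    by move=> x; exact.
  apply: (le_trans h); rewrite leeD2l // lee_fin ltW //.
  by have := ne n; apply => /=.
rewrite -measurable_mu_extE; last exact: bigcapT_measurable.
by apply: le_mu_ext => x Xx n _; have [_ + _] := HB n; exact.
Qed.

Lemma completion_negligible (X : set E) : clambda X = 0%E ->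
  lambda.-negligible X.
Proof.
move=> X0; have [B [mB XB BX]] := measurable_hull X.
by exists B; split => //; rewrite BX.
Qed.

End completion.

Section localization.
Variables (R : realType) (d : nat).
Variable lambda : {finite_measure set (borelRd R d) -> \bar R}.
Local Notation E := 'rV[R]_d.
Local Notation clambda := (completion lambda).
Local Notation T := (completedRd lambda).
Variables (D : set E) (h : E -> R).
Hypothesis mD : measurable (D : set T).
Hypothesis ih : clambda.-integrable (D : set T) (fun x : T => (h x)%:E).

Let mh : measurable_fun (D : set T) (h : T -> R).
Proof. by have /measurable_int/measurable_EFinP := ih. Qed.

(** The bound by [1] makes [|h|] a dominating function. The class is therefore closed under
    pointwise limits, which leads from bumps to indicators of boxes and then along increasing
    unions. *)
Definition annihilates (u : T -> R) :=
  [/\ measurable_fun (D : set T) u, (forall x, `|u x| <= 1) &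
    (\int[clambda]_(x in D) (u x * h x)%:E = 0)%E].

Lemma annihilates_lim (u_ : nat -> T -> R) (u : T -> R) :
  (forall n, annihilates (u_ n)) -> (forall x, u_ n x @[n --> \oo] --> u x) ->
  annihilates u.
Proof.
move=> au cu.
have mu : measurable_fun (D : set T) u.
  apply/measurable_EFinP.
  apply: (emeasurable_fun_cvg (fun n x => (u_ n x)%:E)) => [n|x _].
    by apply/measurable_EFinP; have [] := au n.
  by apply: cvg_EFin; [near=> n|exact: cu].
have u1 x : `|u x| <= 1.
  apply: (cvgr_to_le (cvg_norm (cu x))).
  by near=> n; have [_ + _] := au n; exact.
split => //.
have [] := @dominated_convergence _ T R clambda D mD
  (fun n x => (u_ n x * h x)%:E) (fun x => (u x * h x)%:E)
    (fun x => `|(h x)%:E|%E).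
- by move=> n; apply/measurable_EFinP; apply: measurable_funM => //;
  have [] := au n.
- by apply/measurable_EFinP; apply: measurable_funM.
- apply: aeW => x _; apply: cvg_EFin; first by near=> n.
  by apply: cvgMl; exact: cu.
- exact: integrable_abse.
- apply: aeW => x n _ /=; rewrite lee_fin normrM ler_piMl //.
  by have [_ + _] := au n; exact.
move=> _ _.
rewrite (_ : [sequence _]_n = fun=> 0%E); last first.
  by apply/funext => n /=; have [] := au n.
by move=> /cvg_lim <- //; rewrite lim_cst.
Unshelve. all: by end_near. Qed.

Lemma annihilates_integrable u :
  annihilates u -> clambda.-integrable (D : set T)
    (fun x : T => (u x * h x)%:E).
Proof.
move=> [mu u1 _]; apply: (le_integrable mD) ih.
  by apply/measurable_EFinP; exact: measurable_funM.
by move=> x _; rewrite /= lee_fin normrM ler_piMl.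
Qed.

Lemma annihilates_indicD (A B : set E) : B `<=` A ->
  annihilates \1_A -> annihilates \1_B -> annihilates \1_(A `\` B).
Proof.
move=> BA aA aB; have iE x : \1_(A `\` B) x = \1_A x - \1_B x :> R.
  rewrite !indicE in_setD; have [/set_mem/BA/mem_set ->|] := boolP (x \in B).
    by rewrite subrr.
  by rewrite andbT subr0.
split.
- rewrite (_ : \1_ _ = \1_A \- \1_B); last exact/funext.
  by apply: measurable_funB; [have [] := aA|have [] := aB].
- by move=> x; rewrite indicE; case: (_ \in _); rewrite ?normr1 ?normr0.
under eq_integral => x _ do rewrite iE mulrBl EFinB.
rewrite integralB //; try exact: annihilates_integrable.
by have [_ _ ->] := aA; have [_ _ ->] := aB; rewrite subee.
Qed.

Variables (a0 b0 : E).
Hypothesis box_bump_annihilates : forall a b N, box a b `<=` box a0 b0 ->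
  annihilates (box_bump a b N).
Local Notation Q := (obox a0 b0).

Lemma indic_obox_annihilates a b : annihilates \1_(obox a b `&` Q).
Proof.
rewrite oboxI; set a1 := \row_i _; set b1 := \row_i _.
have sub : box a1 b1 `<=` box a0 b0.
  by apply: box_sub => i; rewrite mxE ?le_max ?ge_min lexx ?orbT.
apply: (annihilates_lim (fun N => box_bump_annihilates N sub)) => x.
rewrite indicE; have [xin|/negP] := boolP (x \in obox a1 b1).
  by apply: box_bump_cvg; exact: set_mem.
rewrite inE => xout; rewrite (_ : (fun _ => _) = fun=> 0); first exact: cvg_cst.
by apply/funext => N; exact: box_bump_out.
Qed.

(** Dynkin's pi-lambda theorem. Traces on the box [Q] are taken because a lambda-system contains the
    whole space, while only bumps living in [box a0 b0] are known to annihilate [h]. *)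
Lemma indic_borel_annihilates (A : set (borelRd R d)) :
  measurable A -> annihilates \1_(A `&` Q).
Proof.
move=> /borel_oboxes; move: A;
  rewrite -/(_ `<=` [set A | annihilates \1_(A `&` Q)]).
apply: lambda_system_subset => //.
- by move=> _ _ [a [b ->]] [a' [b' ->]]; rewrite oboxI; eexists; eexists.
- split => //=.
  + by have := indic_obox_annihilates a0 b0; rewrite setIid setTI.
  + move=> A B BA aA aB /=.
    rewrite (_ : (A `\` B) `&` Q = (A `&` Q) `\` (B `&` Q)).
      by apply: annihilates_indicD => // x [/BA].
    apply/seteqP; split=> x /= [[Ax Bx] Qx]; first by split => // -[].
    by split => //; split => // Bx'; apply: Qx.
  + move=> F ndF aF; apply: (annihilates_lim aF) => x; rewrite indicE.
    have [xin|/negP] := boolP (x \in _).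
      have [[k _ Fk] Qx] := set_mem xin.
      apply: cvg_near_cst; near=> n; rewrite indicE mem_set //; split => //.
      have kn : (k <= n)%N by near: n; exact: nbhs_infty_ge.
      by have /subsetPset := ndF _ _ kn; apply.
    rewrite inE => nF; rewrite (_ : (fun _ => _) = fun=> 0);
      first exact: cvg_cst.
    apply/funext => n; rewrite indicE memNset // => -[Fn Qx]; apply: nF.
    by split => //; exists n.
- by move=> _ [a [b ->]]; exact: indic_obox_annihilates.
Unshelve. all: by end_near. Qed.

Lemma ae_eq0_obox : lambda.-negligible (D `&` Q `&` [set x | h x != 0]).
Proof.
have mQ : measurable (Q : set T).
  by apply: completed_measurable; apply: borelRd_open; exact: open_obox.
have mDQ : measurable (D `&` Q : set T) by exact: measurableI.
have := @integral_ae_eq _ T R clambda _ mDQ (cst 0%E) (fun x : T => (h x)%:E).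
move=> /(_ _ _ _)[].
- by apply: integrableS ih.
- exact: measurable_cst.
- move=> B BDQ mB; rewrite integral0.
  (* [B] is measurable only for the completion. Its Borel hull [A] differs from it by a null set,
     and the integral over the trace of [A] on [Q] is known to vanish. *)
  have [A [mA BA lA]] := measurable_hull lambda B.
  have mA' : measurable (A : set T) by exact: completed_measurable.
  have null : clambda (A `\` B) = 0%E.
    have AB : clambda A = clambda B by rewrite completionE.
    rewrite measureD //; last first.
      by rewrite ltey_eq (completion_fin (lambda := lambda)).
    rewrite setIidr //.
    apply: (eq_trans (f_equal (fun z => (z - clambda B)%E) AB)).
    by rewrite subee // completion_fin.
  have [_ _ <-] := indic_borel_annihilates mA.
  have BD : B `<=` D by move=> x /BDQ[].
  rewrite -(setIidr BD) integral_mkcondr.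
  rewrite (_ : _ \_ B = fun x => (\1_B x * h x)%:E); last first.
    by apply/funext => x; rewrite patchE indicE; case: ifP;
      rewrite ?mul1r ?mul0r.
  have mind (C : set T) : measurable C ->
      measurable_fun (D : set T) (fun x : T => (\1_C x * h x)%:E).
    by move=> mC; apply/measurable_EFinP; apply: measurable_funM.
  apply: (ae_eq_integral _ _ mD (mind _ mB) (mind _ (measurableI _ _ mA' mQ))).
  exists (A `\` B); split => //; first exact: measurableD.
  move=> x /= /not_implyP[Dx neq]; apply: contrapT => nAB.
  apply: neq; rewrite !indicE; congr ((_ %:R * _)%:E).
  have [/set_mem Bx|/negP] := boolP (x \in B).
    by rewrite mem_set //; split; [exact: BA|case: (BDQ _ Bx)].
  rewrite inE => nB; rewrite memNset // => -[Ax _]; exact: nAB (conj Ax nB).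
move=> N [mN N0 sN]; apply: (@negligibleS _ (borelRd R d) R lambda N);
  last first.
  exact: (completion_negligible (lambda := lambda)).
move=> x [DQx hx]; apply: sN => /= /(_ DQx) [] h0; move: hx => /=.
by rewrite h0 eqxx.
Qed.
End localization.

(** [Omega] is the countable union of the open boxes with rational corners whose closed box lies in
    [Omega], and each contributes a null set. Codes that do not decode, and boxes leaving [Omega],
    contribute [set0]. *)
Lemma negligible_of_box_bumps (R : realType) (d : nat)
    (lambda : {finite_measure set (borelRd R d) -> \bar R})
    (D Omega : set 'rV[R]_d) (h : 'rV[R]_d -> R) :
  measurable (D : set (completedRd lambda)) -> open Omega -> Omega `<=` D ->
  (completion lambda).-integrable (D : set (completedRd lambda))
    (fun x : completedRd lambda => (h x)%:E) ->
  (forall a b N, box a b `<=` Omega ->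
    @annihilates R d lambda D h (box_bump a b N)) ->
  lambda.-negligible (Omega `&` [set x | h x != 0]).
Proof.
move=> mD oO OD ih annih.
pose F n : set 'rV[R]_d :=
  if unpickle n is Some c then
    let a := map_mx (@ratr R) c.1 : 'rV[R]_d in
    let b := map_mx (@ratr R) c.2 : 'rV[R]_d in
    if `[< box a b `<=` Omega >] then D `&` obox a b `&` [set x | h x != 0]
      else set0
  else set0.
apply: (@negligibleS _ (borelRd R d) R lambda (\bigcup_n F n)); last first.
  apply: negligible_bigcup => n; rewrite /F.
  case: (unpickle n) => [[a b]|]; last exact: negligible_set0.
  case: asboolP => [abO|_]; last exact: negligible_set0.
  apply: (ae_eq0_obox mD ih) => a' b' N sub; apply: annih.
  exact: subset_trans abO.
move=> x [Ox hx]; have /nbhs_ballP[e /= e0 eO] := open_nbhs_nbhs (conj oO Ox).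
have /choice[a ha] i : exists q : rat, x 0 i - e < ratr q < x 0 i.
  have /rat_in_itvoo[q] : x 0 i - e < x 0 i by rewrite ltrBlDr ltrDl.
  by rewrite in_itv /= => hq; exists q.
have /choice[b hb] i : exists q : rat, x 0 i < ratr q < x 0 i + e.
  have /rat_in_itvoo[q] : x 0 i < x 0 i + e by rewrite ltrDl.
  by rewrite in_itv /= => hq; exists q.
exists (pickle (\row_i a i, \row_i b i)) => //; rewrite /F pickleK /=.
rewrite asboolT /=.
  split => //; split; first exact: OD.
  move=> i; rewrite !mxE; move: (ha i) (hb i) => /andP[_ ->] /andP[h1 _].
  by rewrite h1.
move=> y yab; apply: eO; split => // j i; rewrite (ord1 j) /ball /=.
have := yab i; rewrite !mxE distrC ltr_distl => /andP[h1 h2].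
move: (ha i) (hb i) => /andP[h3 _] /andP[_ h4].
by rewrite (lt_le_trans h3 h1) (le_lt_trans h2 h4).
Qed.

(** * Uniform separability *)

Section density.
Variables (R : realType) (d m : nat).
Local Notation E := 'rV[R]_d.

Lemma continuous_entry (l : 'I_m) (f : E -> 'cV[R]_m) :
  continuous f -> continuous (fun x => f x l 0).
Proof.
move=> cf x; apply: (@continuous_comp _ _ _ f (fun y : 'cV[R]_m => y l 0)).
  exact: cf.
exact: coord_continuous.
Qed.

(* The sequence picks, for each finite list of rational balls with rational
   values, one function that is close to these values on these balls. *)
Lemma uniformly_dense_sequence (K : set E) (I : Type)
    (G : I -> E -> 'cV[R]_m) (i0 : I) :
  compact K -> (forall i l, continuous (fun x => G i x l 0)) ->
  exists c : nat -> I, forall i (e : R), 0 < e ->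
    exists n, forall x, K x -> forall l, `|G i x l 0 - G (c n) x l 0| < e.
Proof.
move=> cK cG.
pose near_val (N : nat) (t : 'rV[rat]_d * rat * 'cV[rat]_m) i :=
  forall x, @ratball R d t.1 x ->
    forall l, `|G i x l 0 - ratr (t.2 l 0)| < N.+1%:R^-1.
pose P (j : nat * seq ('rV[rat]_d * rat * 'cV[rat]_m)) i :=
  forall t, t \in j.2 -> near_val j.1 t i.
have /choice[sel selP] j : exists i, (exists i', P j i') -> P j i.
  have [[i Pi]|nP] := pselect (exists i, P j i); first by exists i.
  by exists i0 => /nP.
exists (fun n => if unpickle n is Some j then sel j else i0) => i e e0.
have e20 : 0 < e / 2 by rewrite divr_gt0.
have [N _ /(_ N (leqnn N)) Ne] := near_infty_natSinv_lt (PosNum e20).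
have := cK; rewrite compact_cover => /(_ _ [set t | near_val N t i]
  (fun t => @ratball R d t.1)).
case.
- by move=> t _; exact: ball_open.
- move=> x Kx.
  have N0 : 0 < N.+1%:R^-1 :> R by [].
  have /choice[v hv] l : exists q : rat, `|G i x l 0 - ratr q| < N.+1%:R^-1.
    have /rat_in_itvoo[q] : G i x l 0 - N.+1%:R^-1 < G i x l 0 + N.+1%:R^-1.
      by rewrite ltrBlDr -addrA ltrDl addr_gt0.
    by rewrite in_itv /= => h; exists q; rewrite distrC ltr_distl.
  pose U := [set y : E | forall l, `|G i y l 0 - ratr (v l)| < N.+1%:R^-1].
  have : nbhs (x : E) U.
    apply: (@filter_forall _ _ _ _ (nbhs_filter (x : E))) => l.
    have : nbhs (G i x l 0) (ball (ratr (v l) : R) N.+1%:R^-1).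
      apply: open_nbhs_nbhs; split; first exact: ball_open.
      by rewrite /ball /= distrC.
    move=> /(cG i l); apply: (@filterS _ _ (nbhs_filter (x : E))) => y.
    by rewrite /= /ball /= distrC.
  rewrite nbhsE => -[V [oV Vx] VU].
  move: Vx; rewrite (open_ratball oV) => -[c /= cV cx].
  exists (c, \col_l v l) => //= y cy l; rewrite mxE; apply: VU; exact: cV.
move=> D' D'P KD'.
(* [i] itself meets the constraints of the finite subcover, so the function selected for this list
   meets them too: both are within [N.+1%:R^-1 < e / 2] of the same rational values. *)
have [Dne|] := pselect (exists i', P (N, finmap.enum_fset D') i'); last first.
  by case; exists i => t tD'; have := D'P t tD'; rewrite inE; exact.
have Psel := selP _ Dne.
exists (pickle (N, finmap.enum_fset D')) => x /KD' [t /= tD' tx] l;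
  rewrite pickleK.
have h1 := set_mem (D'P t tD') x tx l; have h2 := Psel t tD' x tx l.
rewrite (splitr e) -(subrKA (ratr (t.2 l 0))).
apply: (le_lt_trans (ler_normD _ _)); apply: ltrD.
  exact: lt_trans h1 Ne.
by rewrite distrC; exact: lt_trans h2 Ne.
Qed.
End density.

(** * Integrals against charges; functions on the torus *)

Lemma borel_measurable_fun (R : realType) (T : ptopologicalType) (D : set T)
  (f : T -> R) :
  measurable (D : set (borel T)) -> continuous f ->
    measurable_fun (D : set (borel T)) (f : borel T -> R).
Proof.
move=> mD /continuousP cf;
  apply: measurable_funS (@measurableT _ (borel T)) _ _ => //.
apply: (@measurability _ _ (borel T) (measurableTypeR R)
  setT f (@RGenOpens.G R)).
  exact: RGenOpens.measurableE.
move=> _ [_ [a [b ->]] <-]; rewrite setTI; apply: sub_sigma_algebra.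
by apply: cf; exact: itv_open.
Qed.

Lemma entry_le_norm (R : realType) (a b : nat) (M : 'M[R]_(a, b)) i j :
  `|M i j| <= `|M|.
Proof.
rewrite [leRHS]/Num.Def.normr /= mx_normrE.
exact: (le_bigmax _ (fun ij => `|M ij.1 ij.2|) (i, j)).
Qed.

Section boxes.
Variables (R : realType) (d : nat).
Local Notation E := 'rV[R]_d.

Lemma compact_box (a b : E) : compact (box a b).
Proof.
rewrite (_ : box a b = [set v : E | forall i, `[a 0 i, b 0 i]%classic (v 0 i)]).
  by apply: (@rV_compact R d (fun i => `[a 0 i, b 0 i]%classic)) => i;
    exact: segment_compact.
by apply/seteqP; split=> x h i; have := h i; rewrite /= in_itv.
Qed.

Lemma closed_box (a b : E) : closed (box a b).
Proof.
by apply: compact_closed; [exact: norm_hausdorff|exact: compact_box].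
Qed.

Lemma bounded_sub_box (A : set E) : bounded_set A ->
  exists2 M, 0 < M & A `<=` box (const_mx (- M)) (const_mx M).
Proof.
move=> [M [_ hM]]; exists (`|M| + 1) => [|x Ax i]; first by rewrite ltr_pwDr.
rewrite !mxE -ler_norml (le_trans (entry_le_norm _ _ _)) //.
by apply: hM => //; rewrite (le_lt_trans (ler_norm _)) // ltrDl.
Qed.

Lemma bounded_on (f : E -> R) (A : set E) : bounded_set A -> continuous f ->
  exists M, forall x, A x -> `|f x| <= M.
Proof.
move=> /bounded_sub_box[B _ AB] cf.
have [|M [_ hM]] := @compact_bounded R R (f @` (box (const_mx (- B))
  (const_mx B))) _.
  apply: continuous_compact; last exact: compact_box.
  exact: continuous_subspaceT.
by exists (M + 1) => x /AB Bx; apply: hM; [rewrite ltrDl|exists x].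
Qed.

End boxes.

Section charge_integral.
Context disp (T : measurableType disp) (R : realType).
Variables (nu : {charge set T -> \bar R}) (D : set T).
Hypothesis mD : measurable D.
Implicit Types f g : T -> R.

(** Such functions are integrable against every finite measure, hence against both Jordan parts of
    any charge; this makes [charge_integral] linear on them. *)
Definition mbounded f :=
  measurable_fun D f /\ exists M, forall x, D x -> `|f x| <= M.

Lemma mbounded_integrable (mu : {finite_measure set T -> \bar R}) f :
  mbounded f -> mu.-integrable D (EFin \o f).
Proof.
move=> [mf [M fM]]; apply: measurable_bounded_integrable => //.
  by rewrite ltey_eq fin_num_measure.
exists M; split; first exact: num_real.
by move=> N MN x /fM h; exact: le_trans h (ltW MN).
Qed.

Lemma mboundedD f g : mbounded f -> mbounded g -> mbounded (fun x => f x + g x).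
Proof.
move=> [mf [M fM]] [mg [N gN]]; split; first exact: measurable_funD.
by exists (M + N) => x Dx; rewrite (le_trans (ler_normD _ _)) // lerD ?fM ?gN.
Qed.

Lemma mboundedZ (a : R) f : mbounded f -> mbounded (fun x => a * f x).
Proof.
move=> [mf [M fM]]; split; first exact: measurable_funM.
by exists (`|a| * M) => x Dx; rewrite normrM ler_wpM2l ?fM.
Qed.

Lemma mbounded0 : mbounded (fun=> 0).
Proof. by split; [exact: measurable_cst|exists 0 => x _; rewrite normr0]. Qed.

Lemma charge_integralD f g : mbounded f -> mbounded g ->
  charge_integral nu D (fun x => f x + g x) =
  charge_integral nu D f + charge_integral nu D g.
Proof.
move=> mf mg; rewrite /charge_integral !RintegralD //;
  try by apply: mbounded_integrable.
by rewrite opprD addrACA.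
Qed.

Lemma charge_integralZ (a : R) f : mbounded f ->
  charge_integral nu D (fun x => a * f x) = a * charge_integral nu D f.
Proof.
move=> mf; rewrite /charge_integral !RintegralZl //;
  try by apply: mbounded_integrable.
by rewrite mulrBr.
Qed.

Lemma charge_integral0 : charge_integral nu D (fun=> 0) = 0.
Proof. by rewrite /charge_integral /Rintegral !integral0 subrr. Qed.

(** [C] is the total variation of [nu] on [D], the sum of the masses of the two Jordan parts. *)
Lemma charge_integral_le : exists C, forall f M, mbounded f ->
  (forall x, D x -> `|f x| <= M) -> `|charge_integral nu D f| <= C * M.
Proof.
pose mp := jordan_pos (hahn_posneg nu); pose mn := jordan_neg (hahn_posneg nu).
exists (fine (mp D) + fine (mn D)) => f M mf fM.
have bnd (mu : {finite_measure set T -> \bar R}) :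
    `|Rintegral mu D f| <= fine (mu D) * M.
  apply: le_trans (le_normr_Rintegral mD _) _; first exact: mbounded_integrable.
  rewrite mulrC -Rintegral_cst //; apply: le_Rintegral => //.
  - apply: mbounded_integrable; have [m1 [N fN]] := mf; split.
      exact: measurableT_comp.
    by exists N => x Dx; rewrite normr_id fN.
  - apply: mbounded_integrable; split; first exact: measurable_cst.
    by exists `|M|.
rewrite mulrDl; apply: le_trans (ler_normB _ _) _.
by rewrite lerD //; exact: bnd.
Qed.

End charge_integral.

Section periodic.
Variables (R : realType) (d : nat).
Local Notation E := 'rV[R]_d.

Definition lattice_periodic (V : Type) (f : E -> V) :=
  forall x y, lattice_eq x y -> f x = f y.

Lemma torus_pi_eq (x y : E) : (torus_pi x == torus_pi y) = lattice_eq x y.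
Proof.
apply/idP/idP => [/eqP h|h].
  by apply/(eqmodP (lattice_equiv R d)); exact: h.
by apply/eqP; exact: (eqmodP (lattice_equiv R d) _ _ h).
Qed.

Lemma lattice_eq_repr (x : E) : lattice_eq (repr (torus_pi x)) x.
Proof. by rewrite -torus_pi_eq /torus_pi reprK. Qed.

Lemma periodic_repr V (f : E -> V) x : lattice_periodic f ->
  f (repr (torus_pi x)) = f x.
Proof. by move=> pf; apply: pf; exact: lattice_eq_repr. Qed.

Lemma periodic_lift V (f : torus R d -> V) :
  lattice_periodic (f \o @torus_pi R d).
Proof. by move=> x y; rewrite -torus_pi_eq /= => /eqP ->. Qed.

Lemma continuous_repr (f : E -> R) : lattice_periodic f -> continuous f ->
  continuous (fun xi : torus R d => f (repr xi)).
Proof.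
move=> pf cf; apply: (repr_comp_continuous cf) => x y.
by rewrite torus_pi_eq => /pf ->.
Qed.

Definition cube : set E := box 0 (const_mx 1).

Lemma cube_repr (x : E) : exists2 y, cube y & lattice_eq x y.
Proof.
exists (\row_i (x 0 i - (Num.floor (x 0 i))%:~R)).
  move=> i; rewrite !mxE subr_ge0 floor_le /= lerBlDr.
  by have := ltW (floorD1_gt (x 0 i)); rewrite intrD addrC.
by apply/forallP => i; rewrite mxE opprB addrCA subrr addr0 intr_int.
Qed.

Lemma periodic_bounded (f : E -> R) : lattice_periodic f -> continuous f ->
  exists M, forall x, `|f x| <= M.
Proof.
move=> pf cf; have [|M hM] := @bounded_on _ _ f cube _ cf; last first.
  by exists M => x; have [y cy /pf ->] := cube_repr x; exact: hM.
exact/compact_bounded/compact_box.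
Qed.

Lemma periodic_partial (V : normedModType R) (f : E -> V) i :
  lattice_periodic f -> lattice_periodic (partial i f).
Proof.
move=> pf x y xy; rewrite /partial /derive; congr (lim _).
rewrite (_ : (fun h => _) = fun h => h^-1 *: ((f \o shift y)
  (h *: delta_mx 0 i) - f y)) //.
apply/funext => h /=; rewrite (pf x y) //; congr (_ *: (_ - _)); apply: pf.
apply/forallP => k; rewrite !mxE opprD addrACA subrr add0r.
by move/forallP : xy.
Qed.

End periodic.

(** * Two-scale sums *)

Section two_scale_sums.
Variables (R : realType) (d n : nat).
Local Notation E := 'rV[R]_d.
Implicit Types (r : R -> E -> E -> 'cV[R]_n).

(* The functions [r e x y] such that [x |-> r e x (x / e)] is a combination of
   slowly and rapidly varying factors, with nonnegative powers of [e]. *)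
Inductive two_scale_sum : (R -> E -> E -> 'cV[R]_n) -> Prop :=
| two_scale_sum1 (u : E -> R) (v : E -> 'cV[R]_n) : 
    smooth u -> smooth v -> lattice_periodic v ->
    two_scale_sum (fun _ x y => u x *: v y)
| two_scale_sumD r s : two_scale_sum r -> two_scale_sum s ->
    two_scale_sum (fun e x y => r e x y + s e x y)
| two_scale_sumZ r : two_scale_sum r ->
  two_scale_sum (fun e x y => e *: r e x y).

Definition two_scale_eval r (e : R) (x : E) := r e x (e^-1 *: x).

Lemma is_derive_two_scale1 (u : E -> R) (v : E -> 'cV[R]_n) e x i : e != 0 ->
  smooth u -> smooth v ->
  is_derive x (delta_mx 0 i) (fun y => u y *: v (e^-1 *: y))
    (e^-1 *: (u x *: partial i v (e^-1 *: x)) + partial i u x *: v (e^-1 *: x)).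
Proof.
move=> e0 su sv; have ei0 : e^-1 != 0 by rewrite invr_eq0.
have dv := is_derive_dilate ei0 (smooth_derivable (x := e^-1 *: x) (i := i) sv).
have dv1 := @ex_derive _ _ _ _ _ _ _ dv.
apply: DeriveDef; first exact: derivable_scale (smooth_derivable su) dv1.
rewrite derive_scale //; last exact: smooth_derivable.
by rewrite (@derive_val _ _ _ _ _ _ _ dv) scalerA mulrC -scalerA.
Qed.

(** Differentiating a fast factor produces [e^-1], which the prefactor [e] cancels; differentiating
    a slow factor leaves that [e] in place, whence the third constructor of the class. *)
Lemma two_scale_sum_partial r i : two_scale_sum r ->
  exists2 r', two_scale_sum r' &
  forall e, e != 0 -> forall x,
    derivable (two_scale_eval r e) x (delta_mx 0 i) /\
    e *: partial i (two_scale_eval r e) x = two_scale_eval r' e x.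
Proof.
elim=> {r} [u v su sv pv|r s _ [r' hr' r'P] _ [s' hs' s'P]|r _ [r' hr' r'P]].
- exists (fun e x y => u x *: partial i v y + e *: (partial i u x *: v y)).
    apply: two_scale_sumD.
      exact (two_scale_sum1 su (smooth_partial i sv) (periodic_partial i pv)).
    exact (two_scale_sumZ (two_scale_sum1 (smooth_partial i su) sv pv)).
  move=> e e0 x; have [dd de] := is_derive_two_scale1 x i e0 su sv; split=> //.
  by rewrite /partial de scalerDr scalerA divff // scale1r.
- exists (fun e x y => r' e x y + s' e x y);
  first exact (two_scale_sumD hr' hs').
  move=> e e0 x; have [dr er] := r'P e e0 x; have [ds es] := s'P e e0 x.
  split; first exact (derivableD dr ds).
  rewrite -[RHS]/(two_scale_eval r' e x + two_scale_eval s' e x)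
    -er -es -scalerDr.
  by congr (_ *: _); exact (deriveD dr ds).
- exists (fun e x y => e *: r' e x y); first exact (two_scale_sumZ hr').
  move=> e e0 x; have [dr er] := r'P e e0 x.
  split; first exact (derivableZ dr).
  rewrite -[RHS]/(e *: two_scale_eval r' e x) -er.
  by congr (_ *: _); exact (deriveZ e dr).
Qed.

Lemma smooth_two_scale1 (u : E -> R) (v : E -> 'cV[R]_n) e : e != 0 ->
  smooth u -> smooth v -> smooth (fun y => u y *: v (e^-1 *: y)).
Proof.
move=> e0 /smooth_Cn su /smooth_Cn sv; apply/smooth_Cn => j; apply: CnZ => //.
by apply: Cn_dilate => //; rewrite invr_eq0.
Qed.

(** Only the term where every derivative falls on the fast factor has no spare power of [e]. The
    remainder [r] is chosen before [e], so estimates on it are uniform in the scale. *)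
Lemma two_scale_leibniz (u : E -> R) (v : E -> 'cV[R]_n) (s : seq 'I_d) :
  smooth u -> smooth v -> lattice_periodic v -> exists2 r, two_scale_sum r &
  forall e, e != 0 -> forall x,
    e ^+ size s *: foldr (@partial R d _) (fun y => u y *: v (e^-1 *: y)) s x =
    u x *: foldr (@partial R d _) v s (e^-1 *: x) + e *: two_scale_eval r e x.
Proof.
move=> su sv pv; have s0 : smooth (fun _ : E => 0 : R).
  by apply/smooth_Cn => j; exact: Cn_cst.
elim: s => [|i s [r hr rP]].
  (* The remainder is zero here; as the class has no constructor for zero, it is written as a
     product with the zero slow factor. *)
  exists (fun _ x y => 0 *: v y); first exact (two_scale_sum1 s0 sv pv).
  by move=> e e0 x; rewrite expr0 scale1r /two_scale_eval scale0r scaler0 addr0.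
have [r' hr' r'P] := two_scale_sum_partial i hr.
set w := foldr (@partial R d _) v s.
have sw : smooth w by exact: smooth_foldr.
have pw : lattice_periodic w.
  by rewrite /w; elim: (s) => //= k t IH; exact: periodic_partial.
(* Applying [e] times the new partial to [u w + e r] gives the principal term plus [e] times the
   slow derivative of [u] and [e] times the rescaled derivative [r'] of [r]. *)
exists (fun e x y => partial i u x *: w y + r' e x y).
  exact (two_scale_sumD (two_scale_sum1 (smooth_partial i su) sw pw) hr').
move=> e e0 x; set F := fun y => u y *: v (e^-1 *: y).
have sF : smooth (foldr (@partial R d _) F s).
  by apply: smooth_foldr; exact: smooth_two_scale1.
have [dr er] := r'P e e0 x.
have [dd de] := is_derive_two_scale1 x i e0 su sw.
rewrite /= exprS -scalerA -[_ *: partial i _ x]deriveZ;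
  last exact: smooth_derivable.
rewrite (_ : _ \*: _ = (fun y => u y *: w (e^-1 *: y))
  + e \*: two_scale_eval r e); last first.
  by apply/funext => y; rewrite /= rP.
have dZ : derivable (e \*: two_scale_eval r e) x (delta_mx 0 i)
  by exact (derivableZ dr).
rewrite (deriveD dd dZ) de (deriveZ e dr).
rewrite [X in _ + X](er : _ = two_scale_eval r' e x)
  scalerDr scalerDr scalerA divff // scale1r.
rewrite -[RHS]/(u x *: partial i w (e^-1 *: x) +
  e *: (partial i u x *: w (e^-1 *: x) + two_scale_eval r' e x)).
by rewrite scalerDr addrA.
Qed.

Lemma two_scale_sum_bounded r (Omega : set E) (e0 : R) : bounded_set Omega ->
  two_scale_sum r -> exists C, forall e, 0 < e <= e0 -> forall x, Omega x ->
    forall y, `|r e x y| <= C.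
Proof.
move=> bO; elim=> {r} [u v su sv pv|r s _ [C rC] _ [C' sC]|r _ [C rC]].
- have [M vM] : exists M, forall y, `|v y| <= M.
    have [|y|M hM] := @periodic_bounded R d (fun y => `|v y|);
      first by move=> x y /pv ->.
      by apply: continuous_comp;
        [exact: smooth_continuous|exact: norm_continuous].
    by exists M => y; have := hM y; rewrite normr_id.
  have [M' uM] : exists M, forall x, Omega x -> `|u x| <= M.
    by apply: bounded_on => //; exact: smooth_continuous.
  exists (M' * M) => e _ x Ox y; rewrite normrZ.
  by apply: ler_pM => //; exact: uM.
- exists (C + C') => e he x Ox y; apply: le_trans (ler_normD _ _) _.
  by apply: lerD; [exact: rC|exact: sC].
- exists (e0 * C) => e he x Ox y; rewrite normrZ; move: (he) => /andP[h1 h2].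
  by apply: ler_pM => //; [rewrite gtr0_norm|exact: rC].
Qed.

End two_scale_sums.

(** * Sobolev norms of test functions *)

Section multi_indices.
Variables (R : realType) (d k : nat).
Local Notation E := 'rV[R]_d.

Definition mi_seq (al : multi_index d k) : seq 'I_d :=
  flatten [seq nseq (al i) i | i <- enum 'I_d].

Lemma mderivE (V : normedModType R) (al : multi_index d k) (f : E -> V) :
  mderiv al f = foldr (@partial R d V) f (mi_seq al).
Proof.
rewrite /mderiv /mi_seq; elim: (enum 'I_d) => //= i s ->.
by rewrite foldr_cat; elim: (nat_of_ord (al i)) => //= j ->.
Qed.

Lemma size_mi_seq (al : multi_index d k) : size (mi_seq al) = mi_order al.
Proof.
rewrite /mi_order size_flatten /shape -map_comp sumnE big_map big_enum /=.
by apply: eq_bigr => i _; rewrite size_nseq.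
Qed.

Lemma smooth_mderiv (V : normedModType R) (al : multi_index d k) (f : E -> V) :
  smooth f -> smooth (mderiv al f).
Proof. by rewrite mderivE; exact: smooth_foldr. Qed.

Lemma smoothZ (V : normedModType R) (a : R) (f : E -> V) :
  smooth f -> smooth (fun x => a *: f x).
Proof. by move=> /smooth_Cn sf; apply/smooth_Cn => j; apply: CnZl. Qed.

Lemma mderivZ (V : normedModType R) (al : multi_index d k) (a : R)
    (f : E -> V) x :
  smooth f -> mderiv al (fun y => a *: f y) x = a *: mderiv al f x.
Proof.
move=> sf; rewrite !mderivE; elim: (mi_seq al) x => //= i s IH x.
rewrite (_ : foldr _ _ s = fun y => a *: foldr (@partial R d V) f s y);
  last first.
  by apply/funext => y; exact: IH.
by apply: deriveZ; apply: smooth_derivable; exact: smooth_foldr.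
Qed.

End multi_indices.

Section sobolev.
Variables (R : realType) (d n k : nat).
Local Notation E := 'rV[R]_d.

(** The crude constant [n.+1] is positive even for [n = 0], so it can be divided by. *)
Lemma enorm_le (v : 'cV[R]_n) : enorm v <= n.+1%:R * `|v|.
Proof.
have h0 : 0 <= n.+1%:R * `|v| by rewrite mulr_ge0.
rewrite /enorm -[leRHS]ger0_norm // -sqrtr_sqr.
apply: ler_wsqrtr; apply: (@le_trans _ _ (\sum_(i < n) `|v| ^+ 2)).
  apply: ler_sum => i _; rewrite -real_normK ?num_real // lerXn2r ?nnegrE //.
  exact: entry_le_norm.
rewrite sumr_const card_ord -[_ ^+ 2 *+ n]mulr_natl exprMn.
rewrite ler_wpM2r ?sqr_ge0 //.
rewrite (@le_trans _ _ n.+1%:R) ?ler_nat // expr2 ler_peMl //.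
by rewrite ler1n.
Qed.

Lemma measurable_enorm (f : E -> 'cV[R]_n) : continuous f ->
  measurable_fun (setT : set (borelRd R d))
    (fun x : borelRd R d => enorm (f x)).
Proof.
move=> cf; rewrite /enorm.
apply: (@measurableT_comp _ _ _ _ _ _ (@Num.sqrt R)).
  by apply: continuous_measurable_fun; exact: sqrt_continuous.
apply: (@measurable_sum _ _ _ setT _ (index_enum 'I_n) (fun i (x : borelRd R d)
  => f x i 0 ^+ 2)) => i.
apply: measurable_funX; apply: borel_measurable_fun => //.
exact: continuous_entry.
Qed.

Lemma bounded_lebesgue_fin (Omega : set E) : bounded_set Omega ->
  measurable (Omega : set (borelRd R d)) -> (lebesgueRd R d Omega < +oo)%E.
Proof.
move=> /bounded_sub_box[M M0 OM] mO.
apply: (@le_lt_trans _ _ (lebesgueRd R d (box (const_mx (- M)) (const_mx M)))).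
  by apply: le_measure; rewrite ?inE //; exact: measurable_box.
by rewrite lebesgueRd_box ?ltry // => i; rewrite !mxE; lra.
Qed.

(** With [W] the measure of [Omega] counted once per multi-index of order at most [k], derivatives
    bounded by [(W + 1)^(-1/q)] give a sum of integrals at most [W / (W + 1)]. Test functions can
    thus be scaled pointwise, without homogeneity of the norm. *)
Lemma sobolev_norm_le1 (Omega : set E) (q : R) : 0 < q ->
  open Omega -> bounded_set Omega ->
  exists2 e, 0 < e & forall g : E -> 'cV[R]_n, smooth g ->
    (forall al : multi_index d k, (mi_order al <= k)%N ->
      forall x, Omega x -> enorm (mderiv al g x) <= e) ->
    (sobolev_norm k q Omega g <= 1)%E.
Proof.
move=> q0 oO bO.
have mO : measurable (Omega : set (borelRd R d)) by exact: borelRd_open.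
pose L := fine (lebesgueRd R d Omega).
have LE : lebesgueRd R d Omega = L%:E.
  by rewrite fineK // ge0_fin_numE // bounded_lebesgue_fin.
have L0 : 0 <= L by rewrite fine_ge0.
pose W := \sum_(al : multi_index d k | (mi_order al <= k)%N) L.
have W0 : 0 <= W by exact: sumr_ge0.
exists ((W + 1)^-1 `^ q^-1) => [|g sg gle].
  by rewrite powR_gt0 // invr_gt0 ltr_wpDl.
have W1 : 0 < W + 1 by rewrite ltr_wpDl.
rewrite /sobolev_norm -[leRHS](poweR1r q^-1).
apply: gt0_ler_poweR; rewrite ?invr_ge0 ?(ltW q0) // ?in_itv /= ?leey ?andbT //.
  by apply: sume_ge0 => al _; apply: integral_ge0 => x _;
    rewrite lee_fin powR_ge0.
apply: (@le_trans _ _ (\sum_(al : multi_index d k | (mi_order al <= k)%N)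
    ((W + 1)^-1 * L)%:E)%E); last first.
  by rewrite sumEFin lee_fin -mulr_sumr -/W mulrC ler_pdivrMr // mul1r lerDl.
apply: lee_sum => al alk; rewrite EFinM -LE.
have -> : (W + 1)^-1 = ((W + 1)^-1 `^ q^-1) `^ q.
  by rewrite -powRrM mulVf ?gt_eqF // powRr1 // invr_ge0 ltW.
rewrite -integral_cst //; apply: ge0_le_integral => //.
- by move=> x _; rewrite lee_fin powR_ge0.
- apply: measurable_funTS; apply/measurable_EFinP.
  apply: (@measurableT_comp _ _ _ _ _ _ (fun t : R => t `^ q)).
    exact: measurable_powR.
  by apply: measurable_enorm; apply: smooth_continuous; exact: smooth_mderiv.
- move=> x Ox; rewrite lee_fin; apply: ge0_ler_powR;
  rewrite ?nnegrE ?(ltW q0) //.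
  + exact: sqrtr_ge0.
  + exact: powR_ge0.
  + exact: gle.
Qed.

End sobolev.

(** * Oscillating integrals *)

Section adjoint.
Variables (R : realType) (d m n k : nat).
Local Notation E := 'rV[R]_d.
Variable A : multi_index d k -> 'M[R]_(n, m).

Lemma adjoint_opE (h : E -> 'cV[R]_n) x i : adjoint_op A h x i 0 =
  (-1) ^+ k * \sum_(al : multi_index d k | mi_order al == k)
    \sum_l A al l i * mderiv al h x l 0.
Proof.
rewrite /adjoint_op mxE summxE; congr (_ * _); apply: eq_bigr => al _.
by rewrite mxE; apply: eq_bigr => l _; rewrite mxE.
Qed.

Lemma continuous_sum (I : Type) (s : seq I) (P : pred I) (f : I -> E -> R) :
  (forall i, continuous (f i)) ->
    continuous (fun x => \sum_(i <- s | P i) f i x).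
Proof.
move=> cf; elim: s => [|i s IH].
  by under eq_fun do rewrite big_nil; exact: cst_continuous.
under eq_fun do rewrite big_cons; case: (P i) => //.
exact: (@CnD R d 0 R _ _ (cf i) IH).
Qed.

Lemma continuous_adjoint (h : E -> 'cV[R]_n) i :
  smooth h -> continuous (fun x => adjoint_op A h x i 0).
Proof.
move=> sh; under eq_fun do rewrite adjoint_opE.
apply: (@CnZl R d 0 R); apply: continuous_sum => al; apply: continuous_sum => l.
apply: (@CnZl R d 0 R); apply: continuous_entry; apply: smooth_continuous.
exact: smooth_mderiv.
Qed.

Lemma periodic_adjoint (h : E -> 'cV[R]_n) i :
  lattice_periodic h -> lattice_periodic (fun x => adjoint_op A h x i 0).
Proof.
move=> ph x y xy; have pm al : lattice_periodic (mderiv (k := k) al h).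
  by rewrite mderivE; elim: (mi_seq al) => //= j s IH; exact: periodic_partial.
rewrite !adjoint_opE; congr (_ * _).
by apply: eq_bigr => al _; apply: eq_bigr => l _; rewrite (pm al x y xy).
Qed.

End adjoint.

Lemma le_dual_sobolev_norm (R : realType) (d n k : nat) (p : R)
  (Omega : set 'rV[R]_d)
    (T : ('rV[R]_d -> 'cV[R]_n) -> R) g :
  test_fun Omega g -> (sobolev_norm k (p / (p - 1)) Omega g <= 1)%E ->
  (`|T g|%:E <= dual_sobolev_norm k p Omega T)%E.
Proof. by move=> tg sg; apply: ereal_sup_ubound; exists g. Qed.

Section oscillating.
Variables (R : realType) (d m : nat) (Omega : set 'rV[R]_d).
Hypotheses (Omega_open : open Omega) (Omega_bounded : bounded_set Omega).
Variables (eps : nat -> R) (mu : nat -> vmeasure R (borelRd R d) m).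
Hypothesis eps_cvg0 : eps j @[j --> \oo] --> (0 : R).
Local Notation E := 'rV[R]_d.
Local Notation mbd := (@mbounded _ (borelRd R d) R Omega).

Let mO : measurable (Omega : set (borelRd R d)).
Proof. exact: borelRd_open. Qed.

(** The value of the limit is irrelevant: convergence stands in for a bound on the integrals that is
    uniform in [j]. *)
Definition osc_cvg (F : nat -> E -> R) := (forall j, mbd (F j)) /\
  forall i, cvgn (fun j => charge_integral (mu j i) Omega (F j)).

Lemma osc_cvg0 : osc_cvg (fun _ _ => 0).
Proof.
split=> [j|i]; first exact: mbounded0.
by under eq_fun do rewrite charge_integral0; exact: is_cvg_cst.
Qed.

Lemma osc_cvgD F G : osc_cvg F -> osc_cvg G ->
  osc_cvg (fun j x => F j x + G j x).
Proof.
move=> [bF cF] [bG cG]; split=> [j|i]; first exact: mboundedD.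
under eq_fun => j do rewrite (charge_integralD _ mO (bF j) (bG j)).
exact: is_cvgD.
Qed.

Lemma osc_cvgZ (a : nat -> R) F : cvgn a -> osc_cvg F ->
  osc_cvg (fun j x => a j * F j x).
Proof.
move=> ca [bF cF]; split=> [j|i]; first exact: mboundedZ.
under eq_fun => j do rewrite (charge_integralZ _ mO _ (bF j)).
exact: is_cvgM.
Qed.

Lemma osc_cvg_sum (I : Type) (s : seq I) (P : pred I) (F : I -> nat -> E -> R) :
  (forall i, osc_cvg (F i)) -> osc_cvg (fun j x => \sum_(i <- s | P i) F i j x).
Proof.
move=> cF; elim: s => [|i s IH].
  rewrite (_ : (fun _ _ => _) = fun _ _ => 0); first exact: osc_cvg0.
  by apply/funext => j; apply/funext => x; rewrite big_nil.
case Pi : (P i).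
  rewrite (_ : (fun _ _ => _) = fun j x => F i j x + \sum_(i <- s | P i)
    F i j x).
    exact (osc_cvgD (cF i) IH).
  by apply/funext => j; apply/funext => x; rewrite big_cons Pi.
rewrite (_ : (fun _ _ => _) = fun j x => \sum_(i <- s | P i) F i j x) //.
by apply/funext => j; apply/funext => x; rewrite big_cons Pi.
Qed.

Variable lambda : {finite_measure set (borelRd R d) -> \bar R}.
Variable theta : 'rV[R]_d -> vmeasure R (borel (torus R d)) m.
Hypothesis mu_cvg : two_scale_cvg lambda Omega eps mu theta.

Lemma mbounded_osc (u g : E -> R) (e : R) :
  continuous u -> lattice_periodic g -> continuous g ->
  mbd (fun x => u x * g (e *: x)).
Proof.
move=> cu pg cg; split.
  apply: measurable_funM; apply: borel_measurable_fun => //.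
  move=> x; apply: (@continuous_comp _ _ _ (fun y : E => e *: y) g);
    last exact: cg.
  exact: scaler_continuous.
have [M uM] := bounded_on Omega_bounded cu;
  have [N gN] := periodic_bounded pg cg.
by exists (M * N) => x Ox; rewrite normrM ler_pM // uM.
Qed.

Lemma mbounded_torus (g : E -> R) : lattice_periodic g -> continuous g ->
  @mbounded _ (borel (torus R d)) R setT (fun xi : torus R d => g (repr xi)).
Proof.
move=> pg cg; split.
  by apply: borel_measurable_fun => //; exact: continuous_repr.
by have [M gM] := periodic_bounded pg cg; exists M => xi _; exact: gM.
Qed.

Lemma two_scale_cvg1 (u g : E -> R) i :
  continuous u -> lattice_periodic g -> continuous g ->
  let H (x : completedRd lambda) := u x *
    charge_integral (theta x i) setT (fun xi : borel (torus R d)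
      => g (repr xi)) in
  (completion lambda).-integrable (closure Omega : set (completedRd lambda))
    (fun x => (H x)%:E) /\
  charge_integral (mu j i) Omega (fun x => u x * g ((eps j)^-1 *: x))
    @[j --> \oo] -->
  Rintegral (completion lambda) (closure Omega : set (completedRd lambda)) H.
Proof.
move=> cu pg cg H.
have [|iH cH] := mu_cvg (Psi := fun z => u z.1 * g (repr z.2)).
  apply: continuous_subspaceT => z; apply: cvgM.
    by apply: (@continuous_comp _ _ _ fst u); [exact: cvg_fst|exact: cu].
  apply: (@continuous_comp _ _ _ snd (fun xi : torus R d => g (repr xi))).
    exact: cvg_snd.
  exact: continuous_repr.
have HE x : vintegral (theta x) setT (fun xi => u x * g (repr xi)) i 0 = H x.
  by rewrite mxE charge_integralZ //; exact: mbounded_torus.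
split; first by have := iH i; under eq_fun do rewrite HE.
have := cvg_comp _ _ cH (@coord_continuous _ _ _ i 0 _).
rewrite mxE /= (_ : (fun x => vintegral _ _ _ i 0) = H); last exact/funext.
move=> h; apply: cvg_trans h; apply: near_eq_cvg; near=> j.
rewrite /= mxE; congr charge_integral; apply/funext => x.
by rewrite /= (periodic_repr _ pg).
Unshelve. all: by end_near. Qed.

(** Two-scale convergence is used only on products [u x * v y]; sums and factors [eps j] are then
    limits of sums and products. *)
Lemma osc_cvg_two_scale n (r : R -> E -> E -> 'cV[R]_n) l : two_scale_sum r ->
  osc_cvg (fun j x => two_scale_eval r (eps j) x l 0).
Proof.
elim=> {r} [u v su sv pv|r s _ rc _ sc|r _ rc].
- have pvl : lattice_periodic (fun y => v y l 0) by move=> x y /pv ->.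
  have cvl : continuous (fun y => v y l 0).
    by apply: continuous_entry; exact: smooth_continuous.
  have cu := smooth_continuous su.
  rewrite (_ : (fun _ _ => _) = fun j x => u x * v ((eps j)^-1 *: x) l 0);
    last first.
    by apply/funext => j; apply/funext => x; rewrite /two_scale_eval mxE.
  split=> [j|i]; first exact: (mbounded_osc _ cu pvl cvl).
  by have [_ /cvgP] := two_scale_cvg1 i cu pvl cvl.
- have := osc_cvgD rc sc; congr osc_cvg; apply/funext => j; apply/funext => x.
  by rewrite /two_scale_eval mxE.
- have := osc_cvgZ (cvgP _ eps_cvg0) rc; congr osc_cvg; apply/funext => j;
  apply/funext => x.
  by rewrite /two_scale_eval mxE.
Qed.

End oscillating.

(** * Passage to the limit *)

Section limit_equation.
Variables (R : realType) (d m n k : nat) (Omega : set 'rV[R]_d).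
Hypotheses (Omega_open : open Omega) (Omega_bounded : bounded_set Omega).
Variables (A : multi_index d k -> 'M[R]_(n, m)) (p : R).
Hypothesis p_gt1 : 1 < p.
Variables (eps : nat -> R) (mu : nat -> vmeasure R (borelRd R d) m).
Hypothesis eps_gt0 : forall j, 0 < eps j.
Hypothesis eps_cvg0 : eps j @[j --> \oo] --> (0 : R).
Hypothesis eps_noninc : {homo eps : i j / (i <= j)%N >-> j <= i}.
Hypothesis mu_free : asymptotically_free A p Omega mu.
Variable lambda : {finite_measure set (borelRd R d) -> \bar R}.
Variable theta : 'rV[R]_d -> vmeasure R (borel (torus R d)) m.
Hypothesis mu_cvg : two_scale_cvg lambda Omega eps mu theta.
Local Notation E := 'rV[R]_d.

Variables (phi : E -> R) (a b : E) (f : E -> 'cV[R]_n).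
Hypotheses (sphi : smooth phi) (phi_out : forall x, ~ box a b x -> phi x = 0).
Hypothesis abO : box a b `<=` Omega.
Hypotheses (sf : smooth f) (pf : lattice_periodic f).

Let Phi (e : R) : E -> 'cV[R]_n := fun x => phi x *: f (e^-1 *: x).

Let smooth_Phi e : e != 0 -> smooth (Phi e).
Proof. by move=> e0; exact: smooth_two_scale1. Qed.

Lemma two_scale_sumX (r : R -> E -> E -> 'cV[R]_n) j : two_scale_sum r ->
  two_scale_sum (fun e x y => e ^+ j *: r e x y).
Proof.
move=> hr; elim: j => [|j IH].
  rewrite (_ : (fun _ _ _ => _) = r) //.
  by apply/funext => e; apply/funext => x; apply/funext => y; rewrite scale1r.
rewrite (_ : (fun _ _ _ => _) = fun e x y => e *: (e ^+ j *: r e x y)).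
  exact (two_scale_sumZ IH).
by apply/funext => e; apply/funext => x; apply/funext => y;
  rewrite scalerA exprS.
Qed.

(* [eps^k Phi] is bounded in [W^{k,p'}] since its derivatives of order at most
   [k] are two-scale sums. *)
Lemma scaled_test : exists2 c : R, 0 < c & forall j,
  test_fun Omega (fun x => c *: (eps j ^+ k *: Phi (eps j) x)) /\
  (sobolev_norm k (p / (p - 1)) Omega
    (fun x => c *: (eps j ^+ k *: Phi (eps j) x)) <= 1)%E.
Proof.
have q0 : 0 < p / (p - 1) by rewrite divr_gt0 ?subr_gt0 // (lt_trans _ p_gt1).
have [e1 e10 he1] := sobolev_norm_le1 n k q0 Omega_open Omega_bounded.
have /choice[C hC] (al : multi_index d k) : exists C,
    (mi_order al <= k)%N -> forall j x, Omega x ->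
    `|mderiv al (fun y => eps j ^+ k *: Phi (eps j) y) x| <= C.
  have [r hr rP] := two_scale_leibniz (mi_seq al) sphi sf pf.
  (* Of the [k] powers of the scale, [mi_order al] pay for the derivatives; the rest stay as a
     nonnegative power, so [t] belongs to the class. *)
  pose t e x y := e ^+ (k - mi_order al) *:
    (phi x *: foldr (@partial R d _) f (mi_seq al) y + e *: r e x y).
  have ht : two_scale_sum t.
    apply: (@two_scale_sumX (fun e x y =>
      phi x *: foldr (@partial R d _) f (mi_seq al) y + e *: r e x y)).
    refine (two_scale_sumD (two_scale_sum1 sphi (smooth_foldr _ sf) _)
      (two_scale_sumZ hr)).
    by elim: (mi_seq al) => //= i s IH; exact: periodic_partial.
  (* As [eps] is nonincreasing, [eps 0] bounds all scales and [C] is independent of [j]. *)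
  have [C hC] := two_scale_sum_bounded (eps 0%N) Omega_bounded ht.
  exists C => alk j x Ox; have e0 : eps j != 0 by rewrite gt_eqF.
  rewrite mderivZ; last exact: smooth_Phi.
  have -> : eps j ^+ k = eps j ^+ (k - mi_order al) * eps j ^+ mi_order al.
    by rewrite -exprD subnK.
  rewrite -scalerA mderivE -(size_mi_seq al) rP // size_mi_seq.
  by apply: (hC (eps j)) => //; rewrite eps_gt0 eps_noninc.
pose S := \sum_al `|C al|; have S0 : 0 <= S by exact: sumr_ge0.
have CS al : C al <= S.
  apply: le_trans (ler_norm _) _; rewrite /S (bigD1 al) //= lerDl.
  exact: sumr_ge0.
(* [n.+1] passes from the sup norm to [enorm], and [S] bounds all relevant derivatives; [S + 1] is
   positive even if [S = 0]. *)
exists (e1 / (n.+1%:R * (S + 1))).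
  by rewrite divr_gt0 // mulr_gt0 // ltr_wpDl.
set c := _ / _; have c0 : 0 < c by rewrite divr_gt0 // mulr_gt0 // ltr_wpDl.
move=> j; have e0 : eps j != 0 by rewrite gt_eqF.
have sm : smooth (fun x => eps j ^+ k *: Phi (eps j) x)
  by apply/smoothZ/smooth_Phi.
have sT : smooth (fun x => c *: (eps j ^+ k *: Phi (eps j) x))
  by exact: smoothZ.
have supp : closure [set x | c *: (eps j ^+ k *: Phi (eps j) x) != 0]
  `<=` box a b.
  rewrite [X in _ `<=` X]((closure_id _).1 (@closed_box R d a b)).
  apply: closure_subset => x /= h; apply: contrapT => /phi_out p0.
  by move: h; rewrite /Phi p0 scale0r !scaler0 eqxx.
split.
  split => //; last exact: subset_trans abO.
  by apply: subclosed_compact supp; [exact: closed_closure|exact: compact_box].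
apply: he1 => // al alk x Ox; rewrite mderivZ //.
apply: le_trans (enorm_le _) _; rewrite normrZ gtr0_norm //.
rewrite mulrCA /c -mulrA ler_piMr ?(ltW e10) // mulrC ler_pdivrMr ?mul1r.
  rewrite ler_wpM2l // (le_trans (hC al alk j x Ox)) // (le_trans (CS al)) //.
  by rewrite lerDl.
by rewrite mulr_gt0 // ltr_wpDl.
Qed.

Let g i (y : E) := adjoint_op A f y i 0.

Let H i (x : completedRd lambda) :=
  charge_integral (theta x i) setT (fun xi : borel (torus R d)
    => g i (repr xi)).

(** The pairing of the operator applied to [mu j] with the functions of [scaled_test] tends to [0]
    by [mu_free], and to [c] times the left-hand side by two-scale convergence; [c] is positive. *)
Lemma limit_equation :
  \sum_i Rintegral (completion lambda)
    (closure Omega : set (completedRd lambda))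
    (fun x => phi x * H i x) = 0.
Proof.
have [c c0 hc] := scaled_test.
pose Th j x := c *: (eps j ^+ k *: Phi (eps j) x).
have Tcvg0 : diffop A Omega (mu j) (Th j) @[j --> \oo] --> (0 : R).
  apply/norm_cvg0P; apply: (@fine_cvg _ _ _ _ (fun j => `|diffop A Omega (mu j)
    (Th j)|%:E)).
  apply: (squeeze_cvge _ (cvg_cst 0%E) mu_free); near=> j.
  rewrite lee_fin normr_ge0 /=; have [tj sj] := hc j.
  exact: (le_dual_sobolev_norm (diffop A Omega (mu j)) tj sj).
have /choice[r hr] (al : multi_index d k) : exists r : R -> E -> E -> 'cV[R]_n,
    two_scale_sum r /\ forall e, e != 0 -> forall x,
      e ^+ mi_order al *: mderiv al (Phi e) x =
    phi x *: mderiv al f (e^-1 *: x) + e *: two_scale_eval r e x.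
  have [r hr rP] := two_scale_leibniz (mi_seq al) sphi sf pf.
  exists r; split => // e e0 x; rewrite -size_mi_seq !mderivE; exact: rP.
pose Rm i j x := (-1) ^+ k * \sum_(al : multi_index d k | mi_order al == k)
  \sum_l A al l i * two_scale_eval (r al) (eps j) x l 0.
have oR i : osc_cvg Omega mu (Rm i).
  apply: (osc_cvgZ Omega_open (a := fun=> (-1) ^+ k)); first exact: is_cvg_cst.
  apply: (osc_cvg_sum Omega_open) => al; apply: (osc_cvg_sum Omega_open) => l.
  apply: (osc_cvgZ Omega_open (a := fun=> A al l i)); first exact: is_cvg_cst.
  exact: (osc_cvg_two_scale Omega_open Omega_bounded eps_cvg0 mu_cvg l (hr
    al).1).
have cphi := smooth_continuous sphi.
have cg i : continuous (g i) by exact: continuous_adjoint.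
have pg i : lattice_periodic (g i) by exact: periodic_adjoint.
(* All multi-indices here have order exactly [k], so [eps j ^+ k] cancels every negative power of
   the scale and leaves no extra factor on the principal term. *)
have AE i j x : adjoint_op A (Th j) x i 0 =
    c * (phi x * g i ((eps j)^-1 *: x) + eps j * Rm i j x).
  have e0 : eps j != 0 by rewrite gt_eqF.
  rewrite /g !adjoint_opE /Rm mulrCA [eps j * _]mulrCA -mulrDr [c * _]mulrCA.
  congr (_ * _); rewrite !mulr_sumr -big_split mulr_sumr;
    apply: eq_bigr => al /eqP alk.
  rewrite !mulr_sumr -big_split mulr_sumr; apply: eq_bigr => l _ /=.
  have [_ rP] := hr al.
  have -> : mderiv al (Th j) x = c *: (phi x *: mderiv al f ((eps j)^-1 *: x)
      + eps j *: two_scale_eval (r al) (eps j) x).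
    rewrite mderivZ; last by apply/smoothZ/smooth_Phi.
    by rewrite mderivZ; [rewrite -rP // alk|exact: smooth_Phi].
  by rewrite !mxE; ring.
have mO : measurable (Omega : set (borelRd R d)) by exact: borelRd_open.
pose T2 i j := c * (charge_integral (mu j i) Omega
    (fun x => phi x * g i ((eps j)^-1 *: x)) +
  eps j * charge_integral (mu j i) Omega (Rm i j)).
have TE j : diffop A Omega (mu j) (Th j) = \sum_i T2 i j.
  rewrite /diffop /dot_integral; apply: eq_bigr => i _; rewrite /T2.
  have b1 : @mbounded _ (borelRd R d)
    R Omega (fun x => phi x * g i ((eps j)^-1 *: x)).
    exact: (mbounded_osc Omega_open Omega_bounded _ cphi (pg i) (cg i)).
  have b2 := (oR i).1 j.
  rewrite -(charge_integralZ _ mO (eps j) b2) -charge_integralD //;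
    last exact: mboundedZ.
  rewrite -charge_integralZ //; last by apply: mboundedD => //;
    exact: mboundedZ.
  by congr charge_integral; apply/funext => x; exact: AE.
have T2cvg i : T2 i j @[j --> \oo] --> c * Rintegral (completion lambda)
    (closure Omega : set (completedRd lambda)) (fun x => phi x * H i x).
  apply: cvgMr; rewrite -[X in _ --> X]addr0; apply: cvgD.
    exact: (two_scale_cvg1 mu_cvg i cphi (pg i) (cg i)).2.
  rewrite -(mul0r (limn (fun j => charge_integral (mu j i) Omega (Rm i j)))).
  exact: cvgM eps_cvg0 ((oR i).2 i).
have : \sum_i T2 i j @[j --> \oo] --> \sum_i c * Rintegral (completion lambda)
    (closure Omega : set (completedRd lambda)) (fun x => phi x * H i x).
  by apply: cvg_big => [|i _]; [exact: add_continuous|exact: T2cvg].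
rewrite (_ : (fun j => \sum_i _) = fun j => diffop A Omega (mu j) (Th j));
  last first.
  by apply/funext => j; rewrite TE.
move=> /(cvg_unique _ Tcvg0) h.
have /eqP := esym (h (@Rhausdorff R)).
by rewrite -mulr_sumr mulf_eq0 gt_eqF //= => /eqP.
Unshelve. all: by end_near. Qed.

End limit_equation.

(** * Vanishing for one test function, then for all of them simultaneously *)

Section almost_everywhere.
Variables (R : realType) (d m n k : nat) (Omega : set 'rV[R]_d).
Hypotheses (Omega_open : open Omega) (Omega_bounded : bounded_set Omega).
Variables (A : multi_index d k -> 'M[R]_(n, m)) (p : R).
Hypothesis p_gt1 : 1 < p.
Variables (eps : nat -> R) (mu : nat -> vmeasure R (borelRd R d) m).
Hypothesis eps_gt0 : forall j, 0 < eps j.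
Hypothesis eps_cvg0 : eps j @[j --> \oo] --> (0 : R).
Hypothesis eps_noninc : {homo eps : i j / (i <= j)%N >-> j <= i}.
Hypothesis mu_free : asymptotically_free A p Omega mu.
Variable lambda : {finite_measure set (borelRd R d) -> \bar R}.
Variable theta : 'rV[R]_d -> vmeasure R (borel (torus R d)) m.
Hypothesis mu_cvg : two_scale_cvg lambda Omega eps mu theta.
Local Notation E := 'rV[R]_d.

(** The distributional pairing of [A] applied to [theta x] with [psi]. *)
Definition defect (psi : torus R d -> 'cV[R]_n) (x : E) : R :=
  dot_integral (theta x) setT (fun xi => adjoint_op A (psi \o @torus_pi R d)
    (repr xi)).

Lemma defect_negligible psi : smooth (psi \o @torus_pi R d) ->
  lambda.-negligible (Omega `&` [set x | defect psi x != 0]).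
Proof.
set f := psi \o _ => sf; have pf : lattice_periodic f by exact: periodic_lift.
pose g i y := adjoint_op A f y i 0.
have cg i : continuous (g i) by exact: continuous_adjoint.
have pg i : lattice_periodic (g i) by exact: periodic_adjoint.
pose H i (x : E) := charge_integral (theta x i)
  setT (fun xi : borel (torus R d) => g i (repr xi)).
have mD : measurable (closure Omega : set (completedRd lambda)).
  apply: completed_measurable; rewrite -[X in measurable X]setCK.
  by apply: measurableC; apply: borelRd_open; exact/closed_openC/closed_closure.
have intH (u : E -> R) : continuous u ->
  forall i, (completion lambda).-integrable
    (closure Omega : set (completedRd lambda)) (fun x => (u x * H i x)%:E).
  by move=> cu i; exact: (two_scale_cvg1 mu_cvg i cu (pg i) (cg i)).1.
apply: (negligible_of_box_bumps mD) => //; first exact: subset_closure.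
  (* The factor [1] is the constant slow function, for which [intH] gives integrability. *)
  rewrite (_ : (fun x => _) = fun x => (\sum_i (1 * H i x)%:E)%E).
    by apply: integrable_sum => // i _; apply: (intH (fun=> 1));
      exact: cst_continuous.
  by apply/funext => x; rewrite sumEFin; under eq_bigr do rewrite mul1r.
move=> a b N abO; have sb : smooth (box_bump a b N) by exact: smooth_box_bump.
have cb := smooth_continuous sb; split.
- move=> _ Y mY; apply: measurableI => //; apply: completed_measurable.
  have := @borel_measurable_fun R E setT (box_bump a b N)
    (@measurableT _ (borelRd R d)) cb.
  by move=> /(_ (@measurableT _ (borelRd R d)) Y mY); rewrite setTI.
- by move=> x; rewrite ger0_norm ?box_bump_ge0 // box_bump_le1.
rewrite (eq_integral (fun x : completedRd lambda => (\sum_i (box_bump a b N x *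
  H i x)%:E)%E)); last first.
  by move=> x _; rewrite sumEFin -mulr_sumr.
rewrite integral_sum //; last by move=> i; exact: intH.
have out x : ~ box a b x -> box_bump a b N x = 0.
  move=> nx; apply: box_bump_out => ox; apply: nx => i.
  by move: (ox i) => /andP[/ltW -> /ltW ->].
have lim0 := limit_equation Omega_open Omega_bounded p_gt1 eps_gt0 eps_cvg0
  eps_noninc mu_free
  mu_cvg sb out abO sf pf.
(* [Rintegral] truncates the extended integral by [fine]; integrability makes it finite, so nothing
   is lost. *)
transitivity (0 : R)%:E => //; rewrite -lim0 -sumEFin; apply: eq_bigr => i _.
rewrite /Rintegral fineK //; apply: integrable_fin_num => //; exact: intH.
Qed.

(** [defect psi x] depends on [psi] only through the adjoint applied to it, and for fixed [x] it is
    continuous in the uniform norm because [theta x] has finite variation. Vanishing on the dense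
    sequence therefore suffices; the approximating index may depend on [x], but the exceptional set
    does not. *)
Lemma torus_free_ae : {ae lambda, forall x, Omega x -> torus_free A (theta x)}.
Proof.
pose I := {psi : torus R d -> 'cV[R]_n | smooth (psi \o @torus_pi R d)}.
have i0 : I.
  by exists (fun=> 0); apply/smooth_Cn => j; exact: Cn_cst.
pose G (i : I) : E -> 'cV[R]_m := adjoint_op A (sval i \o @torus_pi R d).
have cG i l : continuous (fun x => G i x l 0).
  by apply: continuous_adjoint; exact: (svalP i).
have pG i l : lattice_periodic (fun x => G i x l 0).
  by apply: periodic_adjoint; exact: periodic_lift.
have [c hc] := @uniformly_dense_sequence R d m (@cube R d)
  I G i0 (@compact_box _ _ _ _) cG.
apply: (@negligibleS _ (borelRd R d) R lambda
  (\bigcup_j (Omega `&` [set x | defect (sval (c j)) x != 0]))); last first.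
  by apply: negligible_bigcup => j; exact: defect_negligible (svalP (c j)).
move=> x /= /not_implyP[Ox]; apply: contra_notP => nx psi spsi.
have def0 j : defect (sval (c j)) x = 0.
  by apply/eqP; apply: contra_notT nx => dj; exists j.
have /choice[C hC] l := @charge_integral_le _ _ R (theta x l)
  setT (@measurableT _ _).
pose i : I := exist _ psi spsi.
rewrite -/(defect psi x); apply/eqP; rewrite -normr_le0;
  apply/ler_addgt0Pr => e e0.
pose S := \sum_l `|C l|; have S0 : 0 <= S by exact: sumr_ge0.
have S1 : 0 < S + 1 by rewrite ltr_wpDl.
have [j hj] := hc i (e / (S + 1)) (divr_gt0 e0 S1).
have mb a l := mbounded_torus (pG a l) (cG a l).
rewrite add0r -[defect psi x]subr0 -(def0 j) /defect /dot_integral -sumrB.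
apply: le_trans (ler_norm_sum _ _ _) _.
apply: (@le_trans _ _ (\sum_l `|C l| * (e / (S + 1)))); last first.
  by rewrite -mulr_suml -/S mulrCA ler_piMr ?(ltW e0)
    // ler_pdivrMr // mul1r lerDl.
apply: ler_sum => l _.
rewrite -mulN1r -charge_integralZ //; last exact: (mb (c j) l).
rewrite -charge_integralD //;
  [|exact: (mb i l)|exact: (mboundedZ _ (mb (c j) l))].
apply: (@le_trans _ _ (C l * (e / (S + 1)))); last first.
  by rewrite ler_wpM2r ?ler_norm // ltW // divr_gt0.
apply: hC; first by apply: mboundedD;
  [exact: (mb i l)|exact: (mboundedZ _ (mb (c j) l))].
(* The approximation is known only on the cube; periodicity moves the arbitrary representative
   [repr xi] there. *)
move=> xi _; have [y cy xy] := cube_repr (repr xi).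
rewrite mulN1r (pG i l _ _ xy) (pG (c j) l _ _ xy); apply: ltW; exact: hj.
Qed.

End almost_everywhere.

Unset Implicit Arguments.
Set Strict Implicit.
Set Printing Implicit Defensive.

Theorem corollary5p3 (R : realType) (d m n k : nat)
  (Omega : set 'rV[R]_d)
  (Omega_open : open Omega) (Omega_bounded : bounded_set Omega)
  (Omega_bdry : lebesgueRd R d (closure Omega `\` interior Omega) = 0%E)
  (A : multi_index d k -> 'M[R]_(n, m))
  (p : R) (p_gt1 : 1 < p)
  (* [p < d / (d - 1)], with [d / 0 = +oo] when [d = 1] *)
  (p_lt : p * d.-1%:R < d%:R)
  (eps : nat -> R) (eps_gt0 : forall j, 0 < eps j)
  (eps_noninc : {homo eps : i j / (i <= j)%N >-> j <= i})
  (eps_cvg0 : eps j @[j --> \oo] --> (0 : R))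
  (mu : nat -> vmeasure R (borelRd R d) m)
  (mu_Omega : forall j, concentrated (mu j) Omega)
  (mu_free : asymptotically_free A p Omega mu)
  (lambda : {finite_measure set (borelRd R d) -> \bar R})
  (lambda_Omega : lambda (~` closure Omega) = 0%E)
  (theta : 'rV[R]_d -> vmeasure R (borel (torus R d)) m)
  (theta_meas : weak_star_measurable lambda (closure Omega) theta)
  (mu_cvg : two_scale_cvg lambda Omega eps mu theta) :
  {ae lambda, forall x0, Omega x0 -> torus_free A (theta x0)}.
Proof.
exact: (torus_free_ae Omega_open Omega_bounded p_gt1 eps_gt0 eps_cvg0
  eps_noninc mu_free mu_cvg).
Qed.
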